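(* Let $v,a,b,c\in\mathbb{C}$ with $\Re(v)<3$, $\Re(c)>0$, and $\Re(vc+a+b)>0$, $\Re(vc+a-b)>0$, $\Re(vc-a+b)>0$, $\Re(vc-a-b)>0$. Fix a square root $\sqrt{a^2-b^2}$ and put $\sigma_1=\frac v2-\frac{\sqrt{a^2-b^2}}{2c}$, $\sigma_2=\frac v2+\frac{\sqrt{a^2-b^2}}{2c}$, $\sigma_3=\frac v2-\frac{a}{2c}-\frac{b}{2c}$, $\sigma_4=\frac v2-\frac{a}{2c}+\frac{b}{2c}$, $\sigma_5=\frac v2+\frac{a}{2c}+\frac{b}{2c}$, $\sigma_6=\frac v2+\frac{a}{2c}-\frac{b}{2c}$, $P=(vc-a-b)(vc+a+b)(vc-a+b)(vc+a-b)$; assume $\sigma_1,\sigma_2\notin\mathbb{Z}_0^-$ and $1+\sigma_j\notin\mathbb{Z}_0^-$ ($j=3,4,5,6$). Then $$ \int_0^\infty\frac{\sinh(ax)\cosh(bx)}{\cosh^{v}(cx)}\,dx=\frac{2^{v}(v^2ac^2-a^3+ab^2)}{P}\;{}_7F_6\!\left(\begin{matrix}v,\ 1+\sigma_1,\ 1+\sigma_2,\ \sigma_3,\ \sigma_4,\ \sigma_5,\ \sigma_6\\ \sigma_1,\ \sigma_2,\ 1+\sigma_3,\ 1+\sigma_4,\ 1+\sigma_5,\ 1+\sigma_6\end{matrix};\,-1\right). $$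
   Context: $\mathbb{Z}_0^-=\{0,-1,-2,\dots\}$. The Pochhammer symbol is $(\lambda)_0=1$, $(\lambda)_n=\lambda(\lambda+1)\cdots(\lambda+n-1)$ for $n\ge1$. The generalized hypergeometric series is ${}_pF_q\!\left(\begin{matrix}\alpha_1,\dots,\alpha_p\\ \beta_1,\dots,\beta_q\end{matrix};z\right)=\sum_{n=0}^\infty\frac{(\alpha_1)_n\cdots(\alpha_p)_n}{(\beta_1)_n\cdots(\beta_q)_n}\frac{z^n}{n!}$ (with no $\beta_j\in\mathbb{Z}_0^-$); when $p=q+1$ and $z=-1$ it converges if $\Re(\sum\beta_j-\sum\alpha_i)>-1$. For $\Re(c)>0$ and $x>0$, the complex power $\cosh^{v}(cx)$ means $2^{-v}e^{vcx}(1+e^{-2cx})^{v}$, with the principal branch of $(1+e^{-2cx})^{v}$ (this agrees with the ordinary real power when $c>0$ and $v$ is real). *)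

(* Defs.v *)
From Stdlib Require Import Reals Lra Arith List.
Open Scope R_scope.

Record Cx := mkC { Re : R; Im : R }.

Definition RtoC (x : R) : Cx := mkC x 0.
Definition Cadd (z w : Cx) : Cx := mkC (Re z + Re w) (Im z + Im w).
Definition Copp (z : Cx) : Cx := mkC (- Re z) (- Im z).
Definition Csub (z w : Cx) : Cx := Cadd z (Copp w).
Definition Cmul (z w : Cx) : Cx :=
  mkC (Re z * Re w - Im z * Im w) (Re z * Im w + Im z * Re w).
Definition Cnorm2 (z : Cx) : R := Re z * Re z + Im z * Im z.
Definition Cinv (z : Cx) : Cx := mkC (Re z / Cnorm2 z) (- Im z / Cnorm2 z).
Definition Cdiv (z w : Cx) : Cx := Cmul z (Cinv w).
Definition Cabs (z : Cx) : R := sqrt (Cnorm2 z).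

Definition Cexp (z : Cx) : Cx := mkC (exp (Re z) * cos (Im z)) (exp (Re z) * sin (Im z)).

(* principal argument, with values in (-PI, PI] *)
Definition Carg (z : Cx) : R :=
  let x := Re z in let y := Im z in
  match Rlt_dec 0 x with
  | left _ => atan (y / x)
  | right _ =>
    match Rlt_dec x 0 with
    | left _ => match Rle_dec 0 y with
                | left _ => atan (y / x) + PI
                | right _ => atan (y / x) - PI
                end
    | right _ =>
      match Rlt_dec 0 y with
      | left _ => PI / 2
      | right _ => match Rlt_dec y 0 with
                   | left _ => - (PI / 2)
                   | right _ => 0
                   end
      end
    end
  end.

(* principal logarithm (for z <> 0) *)
Definition Clog (z : Cx) : Cx := mkC (ln (Cabs z)) (Carg z).

(* principal complex power w^v = exp(v Log w) (for w <> 0) *)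
Definition Cpow (w v : Cx) : Cx := Cexp (Cmul v (Clog w)).

Definition Csinh (z : Cx) : Cx := Cmul (RtoC (/2)) (Csub (Cexp z) (Cexp (Copp z))).
Definition Ccosh (z : Cx) : Cx := Cmul (RtoC (/2)) (Cadd (Cexp z) (Cexp (Copp z))).

(* cosh^v(c x) := 2^{-v} e^{v c x} (1 + e^{-2 c x})^v, principal branch *)
Definition cosh_pow (v c : Cx) (x : R) : Cx :=
  let cx := Cmul c (RtoC x) in
  Cmul (Cexp (Copp (Cmul v (RtoC (ln 2)))))
    (Cmul (Cexp (Cmul v cx))
          (Cpow (Cadd (RtoC 1) (Cexp (Cmul (RtoC (-2)) cx))) v)).

Definition improper_integral_0_inf (f : R -> Cx) (L : Cx) : Prop :=
  exists (pre : forall T : R, Riemann_integrable (fun x => Re (f x)) 0 T)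
         (pim : forall T : R, Riemann_integrable (fun x => Im (f x)) 0 T),
    forall eps : R, eps > 0 -> exists M : R, forall T : R, T >= M ->
      Rabs (RiemannInt (pre T) - Re L) < eps /\
      Rabs (RiemannInt (pim T) - Im L) < eps.

Fixpoint Csum (f : nat -> Cx) (n : nat) : Cx :=
  match n with O => RtoC 0 | S m => Cadd (Csum f m) (f m) end.

Definition series_converges_to (f : nat -> Cx) (S : Cx) : Prop :=
  forall eps : R, eps > 0 -> exists N : nat, forall n : nat, (n >= N)%nat ->
    Cabs (Csub (Csum f n) S) < eps.

Fixpoint poch (z : Cx) (n : nat) : Cx :=
  match n with O => RtoC 1 | S m => Cmul (poch z m) (Cadd z (RtoC (INR m))) end.

Definition Cprod_list (l : list Cx) : Cx := List.fold_right Cmul (RtoC 1) l.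

Fixpoint Cpow_nat (z : Cx) (n : nat) : Cx :=
  match n with O => RtoC 1 | S m => Cmul (Cpow_nat z m) z end.

Definition hyp_term (alphas betas : list Cx) (z : Cx) (n : nat) : Cx :=
  Cdiv (Cmul (Cprod_list (List.map (fun a => poch a n) alphas)) (Cpow_nat z n))
       (Cmul (Cprod_list (List.map (fun b => poch b n) betas)) (RtoC (INR (fact n)))).

Definition hypergeom_sum (alphas betas : list Cx) (z : Cx) (S : Cx) : Prop :=
  series_converges_to (hyp_term alphas betas z) S.

Definition not_nonpos_int (z : Cx) : Prop := forall n : nat, z <> RtoC (- INR n).

(* Main.v *)
From Coquelicot Require Import Rcomplements Rbar Hierarchy Continuity Derive AutoDerive RInt RInt_analysis Lim_seq ElemFct.
Require Import Defs.
From Stdlib Require Import Reals ZArith List Psatz.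
Import ListNotations.
Open Scope R_scope.

(** With [w = e^(-2cx)] and [b_n = (-1)^n (v)_n / n!], the integrand is
    [2^v e^(-vcx) sinh(ax) cosh(bx) (1+w)^(-v)], and integrating the binomial series
    [(1+w)^(-v) = sum b_n w^n] term by term gives the hypergeometric series.  The binomial series
    diverges at [w = 1] when [Re v >= 1], so the exchange is justified through a remainder estimate:
    the quotient [S_N / (1+w)^(-v)] of the partial sum tends to 1 at infinity, and the differential
    equation of the binomial series shows that its derivative is [2 c N b_N w^N (1+w)^(v-1)].  As
    [1 + w] stays away from 0 for [x >= 0], the remainder is [O(|b_N| |w|^N)]; since
    [sinh(ax) = O(x)] at 0, its contribution to the integral is [O(|b_N| / N^2)], which tends to 0
    exactly because [Re v < 3]. *)

(** The definition of the improper integral asks for a Riemann integral from 0 to T for every real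
    T, negative T included. For x < 0 one has |w| > 1, and if c is not real then 1 + w crosses the
    cut of the principal logarithm, where the integrand may jump; integrability there needs an
    argument of its own, although the limit concerns large T only. No convergence test is used for
    the series or for the integral. Both convergences come from one estimate comparing the N-th
    partial sum of the integrated series with the integral over [0, T], for T large depending on N.
    The parameters of the series arise as follows. A pair 1 + sigma, sigma contributes (1+sigma)_n /
    (sigma)_n = (sigma+n) / sigma or its inverse, so the n-th term is b_n times a rational function
    of n. That function is the quotient of the values at vc + 2nc and at vc of the Laplace transform
    of sinh(ax) cosh(bx), after division by a. With Q = vc + 2nc the numerator Q^2 - (a^2 - b^2)
    factors over the fixed square root, the origin of sigma_1 and sigma_2; the four linear factors
    of the denominator give sigma_3 to sigma_6. *)

Lemma Cx_eq (z w : Cx) : Re z = Re w -> Im z = Im w -> z = w.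
Proof. destruct z, w; simpl; intros; subst; reflexivity. Qed.

Ltac cx := apply Cx_eq; simpl.

Lemma Cnorm2_neq0 (z : Cx) : z <> RtoC 0 -> Cnorm2 z <> 0.
Proof.
  intros Hz H; apply Hz; unfold Cnorm2 in H; cx; nra.
Qed.

Lemma Cx_field : field_theory (RtoC 0) (RtoC 1) Cadd Cmul Csub Copp Cdiv Cinv eq.
Proof.
  constructor.
  - constructor; intros; cx; ring.
  - intro H; apply (f_equal Re) in H; simpl in H; lra.
  - reflexivity.
  - intros z Hz; pose proof (Cnorm2_neq0 z Hz) as H; cx; unfold Cnorm2 in *; field; exact H.
Qed.

Add Field Cx_field_inst : Cx_field.

Lemma RtoC_add (x y : R) : RtoC (x + y) = Cadd (RtoC x) (RtoC y).
Proof. cx; ring. Qed.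

Lemma RtoC_mul (x y : R) : RtoC (x * y) = Cmul (RtoC x) (RtoC y).
Proof. cx; ring. Qed.

Lemma RtoC_opp (x : R) : RtoC (- x) = Copp (RtoC x).
Proof. cx; ring. Qed.

Lemma RtoC_inj (x y : R) : RtoC x = RtoC y -> x = y.
Proof. intro H; exact (f_equal Re H). Qed.

Lemma RtoC_neq0 (x : R) : x <> 0 -> RtoC x <> RtoC 0.
Proof. intros Hx H; apply Hx, RtoC_inj, H. Qed.

Lemma Re_pos_neq0 (z : Cx) : 0 < Re z -> z <> RtoC 0.
Proof. intros H E; rewrite E in H; simpl in H; lra. Qed.

Lemma Cmul_eq0_l (z w : Cx) : w <> RtoC 0 -> Cmul z w = RtoC 0 -> z = RtoC 0.
Proof. intros Hw E; replace z with (Cdiv (Cmul z w) w) by (field; exact Hw); rewrite E; field; exact Hw. Qed.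

Lemma Cmul_neq0 (z w : Cx) : z <> RtoC 0 -> w <> RtoC 0 -> Cmul z w <> RtoC 0.
Proof. intros Hz Hw E; apply Hz, (Cmul_eq0_l z w Hw E). Qed.

Lemma Cexp_add (z w : Cx) : Cexp (Cadd z w) = Cmul (Cexp z) (Cexp w).
Proof. cx; rewrite exp_plus, ?cos_plus, ?sin_plus; ring. Qed.

Lemma Cexp_0 : Cexp (RtoC 0) = RtoC 1.
Proof. cx; rewrite exp_0, ?cos_0, ?sin_0; ring. Qed.

Lemma Cexp_neq0 (z : Cx) : Cexp z <> RtoC 0.
Proof.
  intro E; apply (RtoC_neq0 1 R1_neq_R0).
  rewrite <- Cexp_0; replace (RtoC 0) with (Cadd z (Copp z)) at 1 by ring.
  rewrite Cexp_add, E; ring.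
Qed.

Lemma Cexp_opp (z : Cx) : Cexp (Copp z) = Cinv (Cexp z).
Proof.
  assert (H : Cmul (Cexp z) (Cexp (Copp z)) = RtoC 1)
    by (rewrite <- Cexp_add, <- Cexp_0; f_equal; ring).
  assert (Hz := Cexp_neq0 z).
  replace (Cexp (Copp z)) with (Cdiv (Cmul (Cexp z) (Cexp (Copp z))) (Cexp z)) by (field; exact Hz).
  rewrite H; field; exact Hz.
Qed.

(** * The modulus of complex numbers *)

Lemma Cnorm2_ge0 (z : Cx) : 0 <= Cnorm2 z.
Proof. unfold Cnorm2; nra. Qed.

Lemma Cabs_ge0 (z : Cx) : 0 <= Cabs z.
Proof. apply sqrt_pos. Qed.

Lemma Cabs_mul (z w : Cx) : Cabs (Cmul z w) = Cabs z * Cabs w.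
Proof.
  unfold Cabs; rewrite <- sqrt_mult by apply Cnorm2_ge0.
  f_equal; unfold Cnorm2; simpl; ring.
Qed.

Lemma Cabs_RtoC (x : R) : Cabs (RtoC x) = Rabs x.
Proof. unfold Cabs, Cnorm2; simpl; rewrite <- sqrt_Rsqr_abs; f_equal; unfold Rsqr; ring. Qed.

Lemma Cabs_opp (z : Cx) : Cabs (Copp z) = Cabs z.
Proof. unfold Cabs; f_equal; unfold Cnorm2; simpl; ring. Qed.

Lemma Cabs_exp (z : Cx) : Cabs (Cexp z) = exp (Re z).
Proof.
  unfold Cabs, Cnorm2; simpl.
  replace (_ + _) with (Rsqr (exp (Re z))).
  - apply sqrt_Rsqr, Rlt_le, exp_pos.
  - pose proof (sin2_cos2 (Im z)) as H; unfold Rsqr in *.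
    transitivity (exp (Re z) * exp (Re z) * (sin (Im z) * sin (Im z) + cos (Im z) * cos (Im z)));
      [rewrite H|]; ring.
Qed.

Lemma Rabs_le_sqrt (x y : R) : x * x <= y -> Rabs x <= sqrt y.
Proof. intro H; rewrite <- sqrt_Rsqr_abs; apply sqrt_le_1_alt; exact H. Qed.

Lemma Rabs_Re_le (z : Cx) : Rabs (Re z) <= Cabs z.
Proof. apply Rabs_le_sqrt; unfold Cnorm2; nra. Qed.

Lemma Rabs_Im_le (z : Cx) : Rabs (Im z) <= Cabs z.
Proof. apply Rabs_le_sqrt; unfold Cnorm2; nra. Qed.

Lemma Cabs_add (z w : Cx) : Cabs (Cadd z w) <= Cabs z + Cabs w.
Proof.
  assert (Hz := Cabs_ge0 z); assert (Hw := Cabs_ge0 w).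
  apply Rsqr_incr_0_var; [|lra].
  assert (Ez : Cabs z * Cabs z = Cnorm2 z) by apply sqrt_sqrt, Cnorm2_ge0.
  assert (Ew : Cabs w * Cabs w = Cnorm2 w) by apply sqrt_sqrt, Cnorm2_ge0.
  assert (E : Cabs (Cadd z w) * Cabs (Cadd z w) = Cnorm2 (Cadd z w)) by apply sqrt_sqrt, Cnorm2_ge0.
  unfold Rsqr; rewrite E.
  assert (H : Re z * Re w + Im z * Im w <= Cabs z * Cabs w).
  { rewrite <- Cabs_mul.
    (* Conjugating w keeps the modulus of the product and turns its real part into the inner product
       of z and w. *)
    replace (Cabs (Cmul z w)) with (Cabs (Cmul z (mkC (Re w) (- Im w)))).
    - eapply Rle_trans; [|apply Rabs_Re_le]; simpl; eapply Rle_trans; [|apply Rle_abs]; lra.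
    - unfold Cabs; f_equal; unfold Cnorm2; simpl; ring. }
  unfold Cnorm2 in *; simpl; nra.
Qed.

Lemma Cabs_le_ReIm (z : Cx) : Cabs z <= Rabs (Re z) + Rabs (Im z).
Proof.
  replace z with (Cadd (RtoC (Re z)) (mkC 0 (Im z))) at 1 by (cx; ring).
  eapply Rle_trans; [apply Cabs_add|]; rewrite Cabs_RtoC.
  apply Rplus_le_compat_l; unfold Cabs, Cnorm2; simpl.
  rewrite <- sqrt_Rsqr_abs; apply sqrt_le_1_alt; unfold Rsqr; lra.
Qed.

Lemma Cabs_inv (z : Cx) : z <> RtoC 0 -> Cabs (Cinv z) = / Cabs z.
Proof.
  intro Hz.
  assert (H : Cabs z * Cabs (Cinv z) = 1).
  { rewrite <- Cabs_mul; replace (Cmul z (Cinv z)) with (RtoC 1) by (field; exact Hz).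
    rewrite Cabs_RtoC; apply Rabs_R1. }
  assert (Cabs z <> 0) by (intro E; rewrite E in H; lra).
  apply (Rmult_eq_reg_l (Cabs z)); [rewrite H; field; assumption | assumption].
Qed.

(** * Differentiation and integration of complex functions of a real variable *)

Definition Cderiv (f : R -> Cx) (x : R) (l : Cx) : Prop :=
  is_derive (fun t => Re (f t)) x (Re l) /\ is_derive (fun t => Im (f t)) x (Im l).

Definition Ccontinuous (f : R -> Cx) (x : R) : Prop :=
  continuous (fun t => Re (f t)) x /\ continuous (fun t => Im (f t)) x.

Definition Climit (f : R -> Cx) (L : Cx) : Prop :=
  filterlim (fun t => Re (f t)) (Rbar_locally p_infty) (locally (Re L)) /\
  filterlim (fun t => Im (f t)) (Rbar_locally p_infty) (locally (Im L)).

Definition CInt (f : R -> Cx) (u v : R) (L : Cx) : Prop :=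
  is_RInt (fun t => Re (f t)) u v (Re L) /\ is_RInt (fun t => Im (f t)) u v (Im L).

Lemma Cderiv_continuous (f : R -> Cx) x l : Cderiv f x l -> Ccontinuous f x.
Proof.
  intros [H1 H2]; split; apply (@ex_derive_continuous R_AbsRing R_NormedModule); eexists; eassumption.
Qed.

Lemma Cderiv_const z x : Cderiv (fun _ => z) x (RtoC 0).
Proof. split; apply (@is_derive_const R_AbsRing R_NormedModule). Qed.

Lemma Cderiv_RtoC x : Cderiv RtoC x (RtoC 1).
Proof. split; simpl; [apply (@is_derive_id R_AbsRing) | apply (@is_derive_const R_AbsRing R_NormedModule)]. Qed.

Lemma Cderiv_eq f x l l' : Cderiv f x l -> l = l' -> Cderiv f x l'.
Proof. intros H <-; exact H. Qed.

Lemma is_derive_eq (f : R -> R) (x l l' : R) : is_derive f x l -> l = l' -> is_derive f x l'.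
Proof. intros H <-; exact H. Qed.

Lemma real_derive_plus (f g : R -> R) (x l m : R) :
  is_derive f x l -> is_derive g x m -> is_derive (fun t => f t + g t) x (l + m).
Proof. intros; apply (@is_derive_plus R_AbsRing R_NormedModule f g); assumption. Qed.

Lemma real_derive_minus (f g : R -> R) (x l m : R) :
  is_derive f x l -> is_derive g x m -> is_derive (fun t => f t - g t) x (l - m).
Proof. intros; apply (@is_derive_minus R_AbsRing R_NormedModule f g); assumption. Qed.

Lemma real_derive_mult (f g : R -> R) (x l m : R) :
  is_derive f x l -> is_derive g x m -> is_derive (fun t => f t * g t) x (l * g x + f x * m).
Proof. intros Hf Hg; exact (is_derive_mult f g x l m Hf Hg Rmult_comm). Qed.

Lemma real_derive_comp (f g : R -> R) (x l m : R) :
  is_derive f (g x) l -> is_derive g x m -> is_derive (fun t => f (g t)) x (m * l).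
Proof. intros; apply (@is_derive_comp R_AbsRing R_NormedModule f g); assumption. Qed.

Lemma Cderiv_add f g x l m :
  Cderiv f x l -> Cderiv g x m -> Cderiv (fun t => Cadd (f t) (g t)) x (Cadd l m).
Proof. intros [] []; split; simpl; apply real_derive_plus; assumption. Qed.

Lemma Cderiv_mul f g x l m :
  Cderiv f x l -> Cderiv g x m ->
  Cderiv (fun t => Cmul (f t) (g t)) x (Cadd (Cmul l (g x)) (Cmul (f x) m)).
Proof.
  intros [] []; split; simpl; eapply is_derive_eq;
    [apply real_derive_minus; apply real_derive_mult; eassumption | simpl; ring
    |apply real_derive_plus; apply real_derive_mult; eassumption | simpl; ring].
Qed.

Lemma Cderiv_scale z f x l : Cderiv f x l -> Cderiv (fun t => Cmul z (f t)) x (Cmul z l).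
Proof.
  intro H; eapply Cderiv_eq; [apply Cderiv_mul; [apply Cderiv_const | exact H] | simpl; ring].
Qed.

Lemma Cderiv_exp f x l : Cderiv f x l -> Cderiv (fun t => Cexp (f t)) x (Cmul l (Cexp (f x))).
Proof.
  intros [H1 H2].
  assert (He : is_derive (fun t => exp (Re (f t))) x (Re l * exp (Re (f x))))
    by (apply (real_derive_comp exp); [apply is_derive_exp | exact H1]).
  split; simpl; eapply is_derive_eq.
  - apply real_derive_mult; [exact He|].
    apply (real_derive_comp cos); [apply is_derive_cos | exact H2].
  - simpl; ring.
  - apply real_derive_mult; [exact He|].
    apply (real_derive_comp sin); [apply is_derive_sin | exact H2].
  - simpl; ring.
Qed.

Lemma Cderiv_expl q x : Cderiv (fun t => Cexp (Cmul q (RtoC t))) x (Cmul q (Cexp (Cmul q (RtoC x)))).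
Proof.
  eapply Cderiv_eq; [apply Cderiv_exp, Cderiv_scale, Cderiv_RtoC | simpl; ring].
Qed.

Lemma Ccontinuous_add f g x :
  Ccontinuous f x -> Ccontinuous g x -> Ccontinuous (fun t => Cadd (f t) (g t)) x.
Proof.
  intros [] []; split; simpl; apply (@continuous_plus R_UniformSpace R_AbsRing R_NormedModule); assumption.
Qed.

Lemma Ccontinuous_mul f g x :
  Ccontinuous f x -> Ccontinuous g x -> Ccontinuous (fun t => Cmul (f t) (g t)) x.
Proof.
  intros [] []; split; simpl;
    [apply (@continuous_minus R_UniformSpace R_AbsRing R_NormedModule)
    |apply (@continuous_plus R_UniformSpace R_AbsRing R_NormedModule)];
    apply (@continuous_mult R_UniformSpace R_AbsRing); assumption.
Qed.

Lemma Ccontinuous_const z x : Ccontinuous (fun _ => z) x.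
Proof. eapply Cderiv_continuous, Cderiv_const. Qed.

Lemma Climit_const z : Climit (fun _ => z) z.
Proof. split; apply filterlim_const. Qed.

Lemma Climit_add f g L M : Climit f L -> Climit g M -> Climit (fun t => Cadd (f t) (g t)) (Cadd L M).
Proof.
  intros [] []; split; simpl; eapply filterlim_comp_2; try eassumption;
    apply (@filterlim_plus R_AbsRing R_NormedModule).
Qed.

Lemma real_limit_mult (u w : R -> R) (p q : R) :
  filterlim u (Rbar_locally p_infty) (locally p) -> filterlim w (Rbar_locally p_infty) (locally q) ->
  filterlim (fun t => u t * w t) (Rbar_locally p_infty) (locally (p * q)).
Proof. intros; eapply filterlim_comp_2; try eassumption; apply (@filterlim_mult R_AbsRing). Qed.

Lemma real_limit_plus (u w : R -> R) (p q : R) :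
  filterlim u (Rbar_locally p_infty) (locally p) -> filterlim w (Rbar_locally p_infty) (locally q) ->
  filterlim (fun t => u t + w t) (Rbar_locally p_infty) (locally (p + q)).
Proof. intros; eapply filterlim_comp_2; try eassumption; apply (@filterlim_plus R_AbsRing R_NormedModule). Qed.

Lemma Climit_mul f g L M : Climit f L -> Climit g M -> Climit (fun t => Cmul (f t) (g t)) (Cmul L M).
Proof.
  intros [] []; split; simpl; [unfold Rminus|]; apply real_limit_plus; try (apply real_limit_mult; assumption).
  eapply (filterlim_comp _ _ _ _ Ropp); [apply real_limit_mult; eassumption|].
  apply (@filterlim_opp R_AbsRing R_NormedModule).
Qed.

Lemma Climit_exp f L : Climit f L -> Climit (fun t => Cexp (f t)) (Cexp L).
Proof.
  intros [H1 H2]; split; simpl;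
  (eapply filterlim_comp_2;
    [eapply filterlim_comp; [exact H1|]; apply continuous_exp
    |eapply filterlim_comp; [exact H2|]; first [apply continuous_cos | apply continuous_sin]
    |apply (@filterlim_mult R_AbsRing)]).
Qed.

Lemma Climit_ext f g L : (forall t, f t = g t) -> Climit f L -> Climit g L.
Proof.
  intros E [H1 H2]; split; [eapply filterlim_ext; [|exact H1] | eapply filterlim_ext; [|exact H2]];
    intro t; simpl; rewrite E; reflexivity.
Qed.

Lemma Climit_squeeze f (B : R -> R) :
  filterlim B (Rbar_locally p_infty) (locally 0) -> (forall t, 0 <= t -> Cabs (f t) <= B t) ->
  Climit f (RtoC 0).
Proof.
  intros HB H.
  assert (Hev : Rbar_locally p_infty (fun t => 0 <= t)) by (exists 0; intros; lra).
  assert (HBm : filterlim (fun t => - B t) (Rbar_locally p_infty) (locally 0)).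
  { rewrite <- Ropp_0; eapply filterlim_comp; [exact HB | apply (@filterlim_opp R_AbsRing R_NormedModule)]. }
  split; simpl; apply (filterlim_le_le (F := Rbar_locally p_infty) (fun t => - B t) _ B (Finite 0));
    try assumption;
    (eapply filter_imp; [|exact Hev]; intros t Ht; specialize (H t Ht));
    apply Rabs_le_between; eapply Rle_trans; try exact H; [apply Rabs_Re_le | apply Rabs_Im_le].
Qed.

Lemma exp_decay_limit (mu : R) : 0 < mu -> filterlim (fun t => exp (- mu * t)) (Rbar_locally p_infty) (locally 0).
Proof.
  intros Hmu.
  assert (H : is_lim (fun t => exp (- mu * t)) p_infty 0).
  { apply (is_lim_comp exp (fun t => - mu * t) p_infty 0 m_infty).
    - apply is_lim_exp_m.
    - replace m_infty with (Rbar_mult (- mu) p_infty).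
      + apply is_lim_scal_l, is_lim_id.
      + simpl; case Rle_dec; intro; [exfalso; lra | reflexivity].
    - exists 0; intros; discriminate. }
  exact H.
Qed.

(** Half of the exponent absorbs the factor t, since t/2 <= e^(t/2). *)
Lemma linear_exp_bound (t : R) : 0 <= t -> t * exp (- t) <= 2 * exp (- (/2) * t).
Proof.
  intro Ht; replace (- t) with (- (/2) * t + - (/2) * t) by field; rewrite exp_plus.
  assert (H1 := exp_ineq1_le (/2 * t)).
  assert (H2 : exp (/2 * t) * exp (- (/2) * t) = 1) by (rewrite <- exp_plus, <- exp_0; f_equal; ring).
  assert (H3 := exp_pos (- (/2) * t)); nra.
Qed.

Lemma CInt_ext f g u v L : (forall t, Rmin u v < t < Rmax u v -> f t = g t) -> CInt f u v L -> CInt g u v L.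
Proof.
  intros E [H1 H2]; split; [eapply is_RInt_ext; [|exact H1] | eapply is_RInt_ext; [|exact H2]];
    intros t Ht; simpl; rewrite (E t Ht); reflexivity.
Qed.

Lemma CInt_deriv f A u v :
  (forall t, Rmin u v <= t <= Rmax u v -> Cderiv A t (f t)) ->
  (forall t, Rmin u v <= t <= Rmax u v -> Ccontinuous f t) -> CInt f u v (Csub (A v) (A u)).
Proof.
  intros HA Hf; split; simpl;
    [apply (is_RInt_derive (fun t => Re (A t)) (fun t => Re (f t)))
    |apply (is_RInt_derive (fun t => Im (A t)) (fun t => Im (f t)))];
    intros t Ht; first [apply (HA t Ht) | apply (Hf t Ht)].
Qed.

Lemma CInt_continuous f u v :
  (forall t, Rmin u v <= t <= Rmax u v -> Ccontinuous f t) -> exists L, CInt f u v L.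
Proof.
  intros Hf.
  destruct (ex_RInt_continuous (V := R_CompleteNormedModule) (fun t => Re (f t)) u v) as [x Hx];
    [intros t Ht; apply (Hf t Ht)|].
  destruct (ex_RInt_continuous (V := R_CompleteNormedModule) (fun t => Im (f t)) u v) as [y Hy];
    [intros t Ht; apply (Hf t Ht)|].
  exists (mkC x y); split; assumption.
Qed.

Lemma CInt_sub f g u v L M :
  CInt f u v L -> CInt g u v M -> CInt (fun t => Csub (f t) (g t)) u v (Csub L M).
Proof. intros [] []; split; simpl; apply (@is_RInt_minus R_NormedModule); assumption. Qed.

Lemma CInt_scale z f u v L : CInt f u v L -> CInt (fun t => Cmul z (f t)) u v (Cmul z L).
Proof.
  intros [H1 H2]; split; simpl.
  - apply (@is_RInt_minus R_NormedModule); apply (@is_RInt_scal R_NormedModule); assumption.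
  - apply (@is_RInt_plus R_NormedModule); apply (@is_RInt_scal R_NormedModule); assumption.
Qed.

Lemma CInt_Chasles f u v w L M : CInt f u v L -> CInt f v w M -> CInt f u w (Cadd L M).
Proof. intros [] []; split; simpl; eapply (@is_RInt_Chasles R_NormedModule); eassumption. Qed.

(** Real and imaginary parts are bounded separately, which costs a factor 2; only orders of
    magnitude matter later. *)
Lemma CInt_bound f (B : R -> R) u v L M :
  u <= v -> (forall t, u <= t <= v -> Cabs (f t) <= B t) -> CInt f u v L -> is_RInt B u v M ->
  Cabs L <= 2 * M.
Proof.
  intros Huv Hf [H1 H2] HB.
  assert (Rabs (Re L) <= M).
  { apply (norm_RInt_le (V := R_NormedModule) (fun t => Re (f t)) B u v); try assumption.
    intros t Ht; eapply Rle_trans; [apply Rabs_Re_le | apply Hf, Ht]. }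
  assert (Rabs (Im L) <= M).
  { apply (norm_RInt_le (V := R_NormedModule) (fun t => Im (f t)) B u v); try assumption.
    intros t Ht; eapply Rle_trans; [apply Rabs_Im_le | apply Hf, Ht]. }
  pose proof (Cabs_le_ReIm L); lra.
Qed.

(** Both B + f and B - f have nonnegative derivative and so are nondecreasing. Comparing derivatives
    avoids integrating f'. *)
Lemma real_derive_dominated (f B : R -> R) (f' B' : R -> R) u v :
  u <= v -> (forall t, u <= t <= v -> is_derive f t (f' t)) ->
  (forall t, u <= t <= v -> is_derive B t (B' t)) ->
  (forall t, u <= t <= v -> Rabs (f' t) <= B' t) -> Rabs (f v - f u) <= B v - B u.
Proof.
  intros Huv Hf HB Hd.
  assert (mono : forall G G' : R -> R, (forall t, u <= t <= v -> is_derive G t (G' t)) ->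
            (forall t, u <= t <= v -> 0 <= G' t) -> G u <= G v).
  { intros G G' HG HG'.
    destruct (MVT_gen G u v G') as (t & Ht & E).
    - intros t; rewrite Rmin_left, Rmax_right by assumption; intros; apply HG; lra.
    - intros t; rewrite Rmin_left, Rmax_right by assumption; intros Ht.
      apply continuity_pt_filterlim, (@ex_derive_continuous R_AbsRing R_NormedModule).
      eexists; apply HG, Ht.
    - rewrite Rmin_left, Rmax_right in Ht by assumption.
      pose proof (HG' t Ht); nra. }
  apply Rabs_le_between; split.
  - assert (H := mono (fun t => B t + f t) (fun t => B' t + f' t)); simpl in H.
    enough (B u + f u <= B v + f v) by lra; apply H.
    + intros; apply real_derive_plus; auto.
    + intros t Ht; specialize (Hd t Ht); apply Rabs_le_between in Hd; lra.
  - assert (H := mono (fun t => B t - f t) (fun t => B' t - f' t)); simpl in H.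
    enough (B u - f u <= B v - f v) by lra; apply H.
    + intros; apply real_derive_minus; auto.
    + intros t Ht; specialize (Hd t Ht); apply Rabs_le_between in Hd; lra.
Qed.

Lemma Cderiv_dominated f f' (B B' : R -> R) u v :
  u <= v -> (forall t, u <= t <= v -> Cderiv f t (f' t)) ->
  (forall t, u <= t <= v -> is_derive B t (B' t)) ->
  (forall t, u <= t <= v -> Cabs (f' t) <= B' t) -> Cabs (Csub (f v) (f u)) <= 2 * (B v - B u).
Proof.
  intros Huv Hf HB Hd.
  assert (H1 : Rabs (Re (f v) - Re (f u)) <= B v - B u).
  { apply (real_derive_dominated (fun t => Re (f t)) B (fun t => Re (f' t)) B'); try assumption.
    - intros; apply Hf; assumption.
    - intros; eapply Rle_trans; [apply Rabs_Re_le | auto]. }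
  assert (H2 : Rabs (Im (f v) - Im (f u)) <= B v - B u).
  { apply (real_derive_dominated (fun t => Im (f t)) B (fun t => Im (f' t)) B'); try assumption.
    - intros; apply Hf; assumption.
    - intros; eapply Rle_trans; [apply Rabs_Im_le | auto]. }
  pose proof (Cabs_le_ReIm (Csub (f v) (f u))) as H; simpl in H.
  unfold Rminus in *; lra.
Qed.

(** Encoded by an antiderivative that vanishes at infinity: the integral over [0, T] is then exactly
    A T - A 0, its tail is -A T, and linear combinations are immediate. The continuity clause makes
    f integrable and is also how the continuity of the kernel is recovered later. *)
Definition improper (f : R -> Cx) (L : Cx) : Prop :=
  exists A, (forall x, Cderiv A x (f x)) /\ (forall x, Ccontinuous f x) /\
    Climit A (RtoC 0) /\ Copp (A 0) = L.

Lemma improper_add f g L M : improper f L -> improper g M -> improper (fun x => Cadd (f x) (g x)) (Cadd L M).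
Proof.
  intros (A & A1 & A2 & A3 & A4) (B & B1 & B2 & B3 & B4).
  exists (fun x => Cadd (A x) (B x)); split; [|split; [|split]].
  - intro x; apply Cderiv_add; auto.
  - intro x; apply Ccontinuous_add; auto.
  - replace (RtoC 0) with (Cadd (RtoC 0) (RtoC 0)) by ring; apply Climit_add; assumption.
  - rewrite <- A4, <- B4; ring.
Qed.

Lemma improper_scale z f L : improper f L -> improper (fun x => Cmul z (f x)) (Cmul z L).
Proof.
  intros (A & A1 & A2 & A3 & A4).
  exists (fun x => Cmul z (A x)); split; [|split; [|split]].
  - intro x; apply Cderiv_scale; auto.
  - intro x; apply Ccontinuous_mul; auto; apply Ccontinuous_const.
  - replace (RtoC 0) with (Cmul z (RtoC 0)) by ring; apply Climit_mul; [apply Climit_const | assumption].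
  - rewrite <- A4; ring.
Qed.

Lemma improper_ext f g L M : (forall x, f x = g x) -> L = M -> improper f L -> improper g M.
Proof.
  intros E <- (A & A1 & A2 & A3 & A4); exists A; split; [|split; [|split]]; try assumption.
  - intro x; rewrite <- E; apply A1.
  - intro x; split; [apply (continuous_ext (fun t => Re (f t))) | apply (continuous_ext (fun t => Im (f t)))];
      try apply A2; intro; rewrite E; reflexivity.
Qed.

Lemma Cabs_expl q t : Cabs (Cexp (Cmul (Copp q) (RtoC t))) = exp (- Re q * t).
Proof. rewrite Cabs_exp; f_equal; simpl; ring. Qed.

Lemma Climit_expl q : 0 < Re q -> Climit (fun t => Cexp (Cmul (Copp q) (RtoC t))) (RtoC 0).
Proof.
  intro Hq; apply (Climit_squeeze _ (fun t => exp (- Re q * t))).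
  - apply exp_decay_limit, Hq.
  - intros t _; rewrite Cabs_expl; apply Rle_refl.
Qed.

Lemma Climit_xexpl q : 0 < Re q -> Climit (fun t => Cmul (RtoC t) (Cexp (Cmul (Copp q) (RtoC t)))) (RtoC 0).
Proof.
  intro Hq; apply (Climit_squeeze _ (fun t => 2 / Re q * exp (- (Re q / 2) * t))).
  - replace (locally 0) with (locally (2 / Re q * 0)) by (f_equal; ring).
    eapply filterlim_comp_2;
      [apply filterlim_const | apply exp_decay_limit; lra | apply (@filterlim_mult R_AbsRing)].
  - intros t Ht; rewrite Cabs_mul, Cabs_expl, Cabs_RtoC, Rabs_pos_eq by assumption.
    assert (H := linear_exp_bound (Re q * t)).
    replace (- Re q * t) with (- (Re q * t)) by ring.
    replace (- (Re q / 2) * t) with (- / 2 * (Re q * t)) by field.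
    apply (Rmult_le_reg_l (Re q)); [assumption|].
    eapply Rle_trans; [|eapply Rle_trans; [apply H; nra|]]; [right; ring | right; field; lra].
Qed.

Lemma improper_exp q : 0 < Re q -> improper (fun t => Cexp (Cmul (Copp q) (RtoC t))) (Cinv q).
Proof.
  intro Hq; assert (Hq0 := Re_pos_neq0 q Hq).
  exists (fun t => Cmul (Copp (Cinv q)) (Cexp (Cmul (Copp q) (RtoC t)))); split; [|split; [|split]].
  - intro x; eapply Cderiv_eq; [apply Cderiv_scale, Cderiv_expl | field; assumption].
  - intro x; eapply Cderiv_continuous, Cderiv_expl.
  - replace (RtoC 0) with (Cmul (Copp (Cinv q)) (RtoC 0)) by ring.
    apply Climit_mul; [apply Climit_const | apply Climit_expl, Hq].
  - replace (Cmul (Copp q) (RtoC 0)) with (RtoC 0) by ring; rewrite Cexp_0; ring.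
Qed.

(** Serves the degenerate case a = 0, where the kernel carries a factor x. *)
Lemma improper_xexp q : 0 < Re q ->
  improper (fun t => Cmul (RtoC t) (Cexp (Cmul (Copp q) (RtoC t)))) (Cmul (Cinv q) (Cinv q)).
Proof.
  intro Hq; assert (Hq0 := Re_pos_neq0 q Hq).
  exists (fun t => Cadd (Cmul (Copp (Cinv q)) (Cmul (RtoC t) (Cexp (Cmul (Copp q) (RtoC t)))))
    (Cmul (Copp (Cmul (Cinv q) (Cinv q))) (Cexp (Cmul (Copp q) (RtoC t))))); split; [|split; [|split]].
  - intro x; eapply Cderiv_eq.
    + apply Cderiv_add; apply Cderiv_scale; [apply Cderiv_mul; [apply Cderiv_RtoC|]|]; apply Cderiv_expl.
    + cbv beta; field; assumption.
  - intro x; eapply Cderiv_continuous, Cderiv_mul; [apply Cderiv_RtoC | apply Cderiv_expl].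
  - replace (RtoC 0) with (Cadd (Cmul (Copp (Cinv q)) (RtoC 0)) (Cmul (Copp (Cmul (Cinv q) (Cinv q))) (RtoC 0))) by ring.
    apply Climit_add; apply Climit_mul; try apply Climit_const; [apply Climit_xexpl | apply Climit_expl]; exact Hq.
  - replace (Cmul (Copp q) (RtoC 0)) with (RtoC 0) by ring; rewrite Cexp_0; ring.
Qed.

(** * The logarithm on the right half-plane *)

(** Free of the case distinctions of [Carg], hence directly differentiable; for x >= 0 every value
    of 1 + w lies where it agrees with [Clog]. *)
Definition log_right (z : Cx) : Cx := mkC (ln (Cabs z)) (atan (Im z / Re z)).

Lemma Clog_right z : 0 < Re z -> Clog z = log_right z.
Proof.
  intro Hz; unfold Clog, Carg, log_right; f_equal; destruct (Rlt_dec 0 (Re z)); [reflexivity | contradiction].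
Qed.

Lemma is_derive_Rinv x : x <> 0 -> is_derive Rinv x (- 1 / x ^ 2).
Proof. intro Hx; exact (is_derive_inv (fun t => t) x 1 (is_derive_id x) Hx). Qed.

Lemma Cderiv_log_right f x l :
  0 < Re (f x) -> Cderiv f x l -> Cderiv (fun t => log_right (f t)) x (Cdiv l (f x)).
Proof.
  intros Hp [H1 H2].
  assert (Hn : 0 < Cnorm2 (f x)) by (unfold Cnorm2; nra).
  assert (Hs : 0 < sqrt (Cnorm2 (f x))) by (apply sqrt_lt_R0, Hn).
  assert (Hss : sqrt (Cnorm2 (f x)) * sqrt (Cnorm2 (f x)) = Cnorm2 (f x)) by (apply sqrt_sqrt; lra).
  split; simpl; eapply is_derive_eq.
  - apply (real_derive_comp ln); [apply is_derive_ln, Hs|].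
    apply (real_derive_comp sqrt (fun t => Cnorm2 (f t))).
    + apply is_derive_Reals, derivable_pt_lim_sqrt, Hn.
    + unfold Cnorm2; apply real_derive_plus; apply real_derive_mult; eassumption.
  - unfold Cabs; transitivity ((Re l * Re (f x) + Im l * Im (f x)) / (sqrt (Cnorm2 (f x)) * sqrt (Cnorm2 (f x)))).
    + field; lra.
    + rewrite Hss; simpl; field; lra.
  - apply (real_derive_comp atan); [apply is_derive_atan|].
    unfold Rdiv; apply real_derive_mult; [exact H2|].
    apply (real_derive_comp Rinv); [apply is_derive_Rinv; lra | exact H1].
  - unfold Rsqr, Cnorm2 in *; simpl; field; split; nra.
Qed.

Lemma Climit_log_right f : Climit f (RtoC 1) -> Climit (fun t => log_right (f t)) (RtoC 0).
Proof.
  intros [H1 H2]; simpl in *; split; simpl.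
  - rewrite <- ln_1, <- sqrt_1.
    apply (filterlim_comp _ _ _ (fun t => Cabs (f t)) ln _ (locally (sqrt 1))).
    + apply (filterlim_comp _ _ _ (fun t => Cnorm2 (f t)) sqrt _ (locally 1));
        [|apply continuity_pt_filterlim, continuity_pt_sqrt; lra].
      replace 1 with (1 * 1 + 0 * 0) by ring.
      apply real_limit_plus; apply real_limit_mult; assumption.
    + apply (@ex_derive_continuous R_AbsRing R_NormedModule); eexists; apply is_derive_ln; rewrite sqrt_1; lra.
  - rewrite <- atan_0; apply (filterlim_comp _ _ _ (fun t => Im (f t) / Re (f t)) atan _ (locally 0));
      [|apply continuous_atan].
    replace (locally 0) with (locally (0 * / 1)) by (f_equal; field).
    apply real_limit_mult; [exact H2|].
    eapply filterlim_comp; [exact H1|].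
    apply (@ex_derive_continuous R_AbsRing R_NormedModule); eexists; apply is_derive_Rinv; lra.
Qed.

(** * The exponential w and the powers of 1 + w *)

Definition decay (c : Cx) (x : R) : Cx := Cexp (Cmul (RtoC (-2)) (Cmul c (RtoC x))).
Definition one_plus_decay (c : Cx) (x : R) : Cx := Cadd (RtoC 1) (decay c x).

Lemma Cabs_decay c x : Cabs (decay c x) = exp (- (2 * Re c) * x).
Proof. unfold decay; rewrite Cabs_exp; f_equal; simpl; ring. Qed.

Lemma Cderiv_decay c x : Cderiv (decay c) x (Cmul (Cmul (RtoC (-2)) c) (decay c x)).
Proof.
  eapply Cderiv_eq; [apply Cderiv_exp, Cderiv_scale, Cderiv_scale, Cderiv_RtoC | unfold decay; ring].
Qed.

Lemma Cderiv_one_plus_decay c x : Cderiv (one_plus_decay c) x (Cmul (Cmul (RtoC (-2)) c) (decay c x)).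
Proof.
  eapply Cderiv_eq; [apply Cderiv_add; [apply Cderiv_const | apply Cderiv_decay] | ring].
Qed.

Lemma decay_expl c x : decay c x = Cexp (Cmul (Copp (Cmul (RtoC 2) c)) (RtoC x)).
Proof. unfold decay; f_equal; replace (RtoC (-2)) with (Copp (RtoC 2)) by (cx; ring); ring. Qed.

Lemma Climit_decay c : 0 < Re c -> Climit (decay c) (RtoC 0).
Proof.
  intro Hc; eapply Climit_ext; [intro; symmetry; apply decay_expl | apply Climit_expl; simpl; lra].
Qed.

(* Near 0 the cosine in the real part is positive; further away the modulus of decay is bounded away from 1. *)
Lemma one_plus_decay_bounds c : 0 < Re c ->
  exists d, 0 < d < 1 /\ forall x, 0 <= x -> d <= Re (one_plus_decay c x).
Proof.
  (* For 0 <= x <= x0 the angle 2 Im(c) x is at most 1 < PI/2 in absolute value; the added 1 keeps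
     the quotient defined when c is real. *)
  intro Hc; set (x0 := / (2 * Rabs (Im c) + 1)).
  assert (Ha := Rabs_pos (Im c)).
  assert (Hx0 : 0 < x0) by (apply Rinv_0_lt_compat; lra).
  assert (He : 0 < exp (- (2 * Re c) * x0) < 1).
  { split; [apply exp_pos|]; rewrite <- exp_0; apply exp_increasing.
    assert (0 < Re c * x0) by (apply Rmult_lt_0_compat; assumption); lra. }
  exists (1 - exp (- (2 * Re c) * x0)); split; [lra|].
  intros x Hx; destruct (Rle_lt_dec x x0) as [Hle | Hlt].
  - simpl; match goal with |- context [cos ?u] => assert (Hcos : 0 <= cos u) end.
    { assert (HP := PI2_1).
      assert (Hb : Rabs (2 * Im c * x) <= 1).
      { rewrite !Rabs_mult, (Rabs_pos_eq 2), (Rabs_pos_eq x) by lra.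
        assert ((2 * Rabs (Im c) + 1) * x0 = 1) by (unfold x0; field; lra); nra. }
      apply Rabs_le_between in Hb; apply cos_ge_0; lra. }
    match goal with |- context [exp ?u * cos ?y] => assert (H := exp_pos u) end.
    assert (H2 := Rmult_le_pos _ _ (Rlt_le _ _ H) Hcos); lra.
  - assert (H := Rabs_Re_le (decay c x)); rewrite Cabs_decay in H.
    assert (H2 : exp (- (2 * Re c) * x) <= exp (- (2 * Re c) * x0)).
    { left; apply exp_increasing; nra. }
    apply Rabs_le_between in H; unfold one_plus_decay, Cadd; simpl Re; simpl in H |- *; lra.
Qed.

Lemma one_plus_decay_pos c x : 0 < Re c -> 0 <= x -> 0 < Re (one_plus_decay c x).
Proof. intros Hc Hx; destruct (one_plus_decay_bounds c Hc) as (d & Hd & H); specialize (H x Hx); lra. Qed.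

(** For z = 1 + w the modulus of z^u is exp(Re u ln|z| - Im u arg z), where d <= |z| <= 2 and |arg
    z| <= PI/2. As d < 1, the sum -ln d + ln 2 dominates |ln|z||. *)
Lemma power_one_plus_decay_bounded u c : 0 < Re c ->
  exists M, 0 < M /\ forall x, 0 <= x -> Cabs (Cexp (Cmul u (log_right (one_plus_decay c x)))) <= M.
Proof.
  intro Hc; destruct (one_plus_decay_bounds c Hc) as (d & Hd & H).
  exists (exp (Rabs (Re u) * (- ln d + ln 2) + Rabs (Im u) * (PI / 2))); split; [apply exp_pos|].
  intros x Hx; rewrite Cabs_exp; specialize (H x Hx).
  set (z := one_plus_decay c x) in *.
  assert (Hd0 : ln d < 0) by (rewrite <- ln_1; apply ln_increasing; lra).
  assert (H20 : 0 < ln 2) by (rewrite <- ln_1; apply ln_increasing; lra).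
  assert (L1 : d <= Cabs z) by (eapply Rle_trans; [exact H|]; eapply Rle_trans; [apply Rle_abs | apply Rabs_Re_le]).
  assert (L2 : Cabs z <= 2).
  { eapply Rle_trans; [apply Cabs_add|]; rewrite Cabs_RtoC, Rabs_R1, Cabs_decay.
    enough (exp (- (2 * Re c) * x) <= exp 0) by (rewrite exp_0 in *; lra).
    destruct (Req_dec x 0) as [->|]; [right; f_equal; ring | left; apply exp_increasing; nra]. }
  assert (E1 : Rabs (ln (Cabs z)) <= - ln d + ln 2).
  { assert (ln d <= ln (Cabs z)) by (apply ln_le; lra).
    assert (ln (Cabs z) <= ln 2) by (apply ln_le; lra).
    apply Rabs_le; lra. }
  assert (E2 : Rabs (atan (Im z / Re z)) <= PI / 2).
  { apply Rabs_le; destruct (atan_bound (Im z / Re z)); lra. }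
  assert (E3 : Re (Cmul u (log_right z)) <= Rabs (Re u) * (- ln d + ln 2) + Rabs (Im u) * (PI / 2)).
  { simpl; unfold Rminus; apply Rplus_le_compat.
    - eapply Rle_trans; [apply Rle_abs|]; rewrite Rabs_mult; apply Rmult_le_compat_l; [apply Rabs_pos | exact E1].
    - eapply Rle_trans; [apply Rle_abs|]; rewrite Rabs_Ropp, Rabs_mult; apply Rmult_le_compat_l; [apply Rabs_pos | exact E2]. }
  destruct E3 as [E3 | ->]; [left; apply exp_increasing, E3 | right; reflexivity].
Qed.

(** * The binomial coefficients and the remainder of the binomial series *)

(** The binomial coefficient of -v over n, written so that it splits off literally from [hyp_term]
    at z = -1. *)
Definition bincoef (v : Cx) (n : nat) : Cx :=
  Cdiv (Cmul (poch v n) (Cpow_nat (RtoC (-1)) n)) (RtoC (INR (fact n))).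

Lemma INR_fact_Cx_neq0 n : RtoC (INR (fact n)) <> RtoC 0.
Proof. apply RtoC_neq0, INR_fact_neq_0. Qed.

Lemma INR_S_Cx_neq0 n : RtoC (INR (S n)) <> RtoC 0.
Proof. apply RtoC_neq0, not_0_INR; discriminate. Qed.

Lemma bincoef_0 v : bincoef v 0 = RtoC 1.
Proof. unfold bincoef; simpl; field; apply RtoC_neq0; lra. Qed.

Lemma bincoef_S v n :
  Cmul (RtoC (INR (S n))) (bincoef v (S n)) = Copp (Cmul (bincoef v n) (Cadd v (RtoC (INR n)))).
Proof.
  assert (H1 := INR_S_Cx_neq0 n); assert (H2 := INR_fact_Cx_neq0 n).
  unfold bincoef; cbn [poch Cpow_nat].
  replace (RtoC (INR (fact (S n)))) with (Cmul (RtoC (INR (S n))) (RtoC (INR (fact n))))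
    by (rewrite <- RtoC_mul, <- mult_INR; reflexivity).
  replace (RtoC (-1)) with (Copp (RtoC 1)) by (cx; ring).
  field; split; assumption.
Qed.

Lemma Cabs_bincoef_S v n :
  Cabs (bincoef v (S n)) = Cabs (bincoef v n) * Cabs (Cadd v (RtoC (INR n))) / INR (S n).
Proof.
  assert (H := f_equal Cabs (bincoef_S v n)).
  rewrite Cabs_opp, !Cabs_mul, Cabs_RtoC, (Rabs_pos_eq _ (pos_INR _)) in H.
  assert (0 < INR (S n)) by (apply lt_0_INR; lia).
  rewrite <- H; field; lra.
Qed.

(** With m = n + 3, the real part of v + n is m - 2d. Half of the gap 2d = 3 - Re v is spent on the
    imaginary part, giving |v+n| <= m - d for large n; the other half survives as the gain
    (m/(m+1))^d, because 1 - d/m <= e^(-d/m) and ln(m+1) - ln m <= 1/m. *)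
Lemma step_decay (v : Cx) (d : R) n :
  0 < d -> d = (3 - Re v) / 2 -> Im v * Im v <= d * (2 * INR n + 3 - d + Re v) -> d <= INR n + 3 ->
  Cabs (Cadd v (RtoC (INR n))) <= (INR n + 3) * exp (- d * (ln (INR (S n) + 3) - ln (INR n + 3))).
Proof.
  intros Hd E Hi Hn; assert (Hp := pos_INR n); set (m := INR n + 3) in *.
  assert (Hm : 0 < m) by (unfold m; lra).
  assert (H1 : Cabs (Cadd v (RtoC (INR n))) <= m - d).
  { replace (m - d) with (sqrt (Rsqr (m - d))) by (apply sqrt_Rsqr; lra).
    apply sqrt_le_1_alt; unfold Cnorm2, Rsqr, m; simpl.
    replace (Re v) with (3 - 2 * d) in * by lra; nra. }
  replace (INR (S n) + 3) with (m + 1) by (rewrite S_INR; unfold m; ring).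
  assert (H2 : ln (m + 1) - ln m <= / m).
  { rewrite <- ln_div by lra.
    assert (H := exp_ineq1_le (/ m)).
    assert (0 < / m) by (apply Rinv_0_lt_compat, Hm).
    rewrite <- (ln_exp (/ m)); apply ln_le; [|replace ((m + 1) / m) with (1 + / m) by (field; lra); exact H].
    apply Rdiv_lt_0_compat; lra. }
  assert (H3 : 1 - d / m <= exp (- d * (ln (m + 1) - ln m))).
  { eapply Rle_trans; [|apply exp_ineq1_le]; unfold Rdiv; nra. }
  eapply Rle_trans; [exact H1|].
  replace (m - d) with (m * (1 - d / m)) by (field; lra).
  apply Rmult_le_compat_l; lra.
Qed.

(** |b_N| behaves like a power of N with exponent Re v - 1 < 2. Only o(N^2) is needed, so a monotone
    quantity replaces Gamma function asymptotics. *)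
Lemma bincoef_growth v : Re v < 3 -> forall eps, 0 < eps ->
  exists N0, forall N, (N0 <= N)%nat -> Cabs (bincoef v N) <= eps * (INR N * INR N).
Proof.
  intros Hv eps Heps; set (d := (3 - Re v) / 2).
  assert (Hd : 0 < d) by (unfold d; lra).
  assert (Hk : exists k, forall n, (k <= n)%nat ->
     Im v * Im v <= d * (2 * INR n + 3 - d + Re v) /\ d <= INR n + 3).
  { destruct (INR_unbounded (Im v * Im v / d + d + Rabs (Re v))) as [k Hk].
    exists k; intros n Hn; apply le_INR in Hn.
    assert (HR := Rle_abs (- Re v)); rewrite Rabs_Ropp in HR.
    assert (0 <= Im v * Im v / d) by (apply Rmult_le_pos; [nra | left; apply Rinv_0_lt_compat, Hd]).
    assert (HRp := Rabs_pos (Re v)); split; [|lra].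
    assert (Im v * Im v = d * (Im v * Im v / d)) as -> by (field; lra).
    apply Rmult_le_compat_l; lra. }
  destruct Hk as [k Hk].
  (* From N to N + 1 the denominator grows by (N+3)/(N+1), which matches the bound |v+N|/(N+1) for
     the growth of |b_N|; the gain of [step_decay] compensates the growth of (N+3)^d. *)
  set (e N := Cabs (bincoef v N) * exp (d * ln (INR N + 3)) / ((INR N + 1) * (INR N + 2))).
  assert (Hdec : forall N, (k <= N)%nat -> e N <= e k).
  { induction 1 as [|N HN IH]; [apply Rle_refl|].
    eapply Rle_trans; [|exact IH]; destruct (Hk N HN) as [H1 H2].
    assert (Hp := pos_INR N).
    assert (H := step_decay v d N Hd eq_refl H1 H2).
    unfold e; rewrite Cabs_bincoef_S, (S_INR N) in *.
    set (y := Cabs (Cadd v (RtoC (INR N)))) in *; set (B := Cabs (bincoef v N)).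
    assert (HB : 0 <= B) by apply Cabs_ge0.
    apply (Rmult_le_reg_r ((INR N + 1) * (INR N + 2) * (INR N + 3))); [apply Rmult_lt_0_compat; nra|].
    replace (B * y / (INR N + 1) * exp (d * ln (INR N + 1 + 3)) / ((INR N + 1 + 1) * (INR N + 1 + 2)) *
       ((INR N + 1) * (INR N + 2) * (INR N + 3)))
      with (B * (y * exp (d * ln (INR N + 1 + 3)))) by (field; lra).
    replace (B * exp (d * ln (INR N + 3)) / ((INR N + 1) * (INR N + 2)) * ((INR N + 1) * (INR N + 2) * (INR N + 3)))
      with (B * ((INR N + 3) * exp (d * ln (INR N + 3)))) by (field; lra).
    apply Rmult_le_compat_l; [exact HB|].
    replace (d * ln (INR N + 3)) with (- d * (ln (INR N + 1 + 3) - ln (INR N + 3)) + d * ln (INR N + 1 + 3)) by ring.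
    rewrite exp_plus, <- Rmult_assoc; apply Rmult_le_compat_r; [left; apply exp_pos | exact H]. }
  assert (He : 0 <= e k).
  { unfold e; assert (Hp := pos_INR k); apply Rmult_le_pos; [apply Rmult_le_pos; [apply Cabs_ge0 | left; apply exp_pos]|].
    left; apply Rinv_0_lt_compat; nra. }
  (* Beyond k' one has (N+3)^d >= 6 (e k + 1) / eps. The 6 comes from (N+1)(N+2) <= 6 N^2 for N >=
     1, and the added 1 keeps the argument of ln positive even if e k = 0. *)
  destruct (INR_unbounded (exp (ln (6 * (e k + 1) / eps) / d))) as [k' Hk'].
  exists (S (k + k')); intros N HN.
  assert (HkN : (k <= N)%nat) by lia; specialize (Hdec N HkN).
  assert (HN' : INR k' <= INR N) by (apply le_INR; lia).
  assert (HN1 : 1 <= INR N) by (apply (le_INR 1); lia).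
  assert (Hpos : 0 < 6 * (e k + 1) / eps) by (apply Rdiv_lt_0_compat; lra).
  assert (Hbig : 6 * (e k + 1) / eps <= exp (d * ln (INR N + 3))).
  { rewrite <- (exp_ln _ Hpos) at 1.
    assert (Hl : ln (6 * (e k + 1) / eps) / d <= ln (INR N + 3)).
    { rewrite <- (ln_exp (ln (6 * (e k + 1) / eps) / d)); apply ln_le; [apply exp_pos | lra]. }
    assert (ln (6 * (e k + 1) / eps) <= d * ln (INR N + 3)) as [Hlt | ->].
    { apply (Rmult_le_compat_l d) in Hl; [|lra].
      replace (d * (ln (6 * (e k + 1) / eps) / d)) with (ln (6 * (e k + 1) / eps)) in Hl by (field; lra); exact Hl. }
    - left; apply exp_increasing, Hlt.
    - apply Rle_refl. }
  assert (HB := Cabs_ge0 (bincoef v N)); set (B := Cabs (bincoef v N)) in *.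
  assert (Hdec' : B * exp (d * ln (INR N + 3)) <= e k * ((INR N + 1) * (INR N + 2))).
  { apply (Rmult_le_compat_r ((INR N + 1) * (INR N + 2))) in Hdec; [|nra].
    eapply Rle_trans; [|exact Hdec]; right; unfold e, B; field; lra. }
  assert (H6 : (INR N + 1) * (INR N + 2) <= 6 * (INR N * INR N)) by nra.
  assert (Hfin : B * (6 * (e k + 1) / eps) <= 6 * (e k + 1) * (INR N * INR N)).
  { eapply Rle_trans; [apply Rmult_le_compat_l; [exact HB | exact Hbig]|].
    eapply Rle_trans; [exact Hdec'|].
    eapply Rle_trans; [apply Rmult_le_compat_l; [exact He | exact H6]|]; nra. }
  apply (Rmult_le_reg_r (6 * (e k + 1) / eps)); [exact Hpos|].
  eapply Rle_trans; [exact Hfin|]; right; field; lra.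
Qed.

Definition binsum (v w : Cx) (N : nat) : Cx := Csum (fun n => Cmul (bincoef v n) (Cpow_nat w n)) N.
(** The Euler operator w d/dw applied to [binsum]: differentiating w^n in x gives -2c n w^n, without
    lowering the power. *)
Definition binsum_diff (v w : Cx) (N : nat) : Cx :=
  Csum (fun n => Cmul (RtoC (INR n)) (Cmul (bincoef v n) (Cpow_nat w n))) N.

(* The defect of the partial sums in the differential equation (1+w) f' + v f = 0, multiplied by w. *)
Lemma binsum_ode v w N :
  Cadd (Cmul (Cadd (RtoC 1) w) (binsum_diff v w N)) (Cmul (Cmul v w) (binsum v w N)) =
  Copp (Cmul (RtoC (INR N)) (Cmul (bincoef v N) (Cpow_nat w N))).
Proof.
  induction N as [|N IH]; [unfold binsum, binsum_diff; simpl Csum; simpl INR; ring|].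
  change (binsum v w (S N)) with (Cadd (binsum v w N) (Cmul (bincoef v N) (Cpow_nat w N))).
  change (binsum_diff v w (S N)) with
    (Cadd (binsum_diff v w N) (Cmul (RtoC (INR N)) (Cmul (bincoef v N) (Cpow_nat w N)))).
  transitivity (Cadd (Cadd (Cmul (Cadd (RtoC 1) w) (binsum_diff v w N)) (Cmul (Cmul v w) (binsum v w N)))
    (Cmul (Cpow_nat w N) (Cadd (Cmul (RtoC (INR N)) (bincoef v N))
      (Cmul w (Cmul (bincoef v N) (Cadd v (RtoC (INR N)))))))); [ring|].
  rewrite IH; cbn [Cpow_nat].
  replace (Cmul (bincoef v N) (Cadd v (RtoC (INR N)))) with (Copp (Cmul (RtoC (INR (S N))) (bincoef v (S N))))
    by (rewrite bincoef_S; ring).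
  ring.
Qed.

Lemma Cderiv_decay_pow c n x :
  Cderiv (fun t => Cpow_nat (decay c t) n) x
    (Cmul (Cmul (RtoC (-2)) c) (Cmul (RtoC (INR n)) (Cpow_nat (decay c x) n))).
Proof.
  induction n as [|n IH]; cbn [Cpow_nat].
  - eapply Cderiv_eq; [apply Cderiv_const | simpl INR; ring].
  - eapply Cderiv_eq; [apply Cderiv_mul; [exact IH | apply Cderiv_decay]|].
    rewrite S_INR, RtoC_add; cbv beta; ring.
Qed.

Lemma Cderiv_binsum v c N x :
  Cderiv (fun t => binsum v (decay c t) N) x (Cmul (Cmul (RtoC (-2)) c) (binsum_diff v (decay c x) N)).
Proof.
  unfold binsum, binsum_diff; induction N as [|N IH]; cbn [Csum].
  - eapply Cderiv_eq; [apply Cderiv_const | ring].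
  - eapply Cderiv_eq; [apply Cderiv_add; [exact IH | apply Cderiv_scale, Cderiv_decay_pow] | ring].
Qed.

(** The limit is the constant term b_0 = 1; the index S N excludes the empty sum, whose limit is
    0. *)
Lemma Climit_binsum v c N : 0 < Re c -> Climit (fun t => binsum v (decay c t) (S N)) (RtoC 1).
Proof.
  intro Hc; unfold binsum; induction N as [|N IH].
  - apply (Climit_ext (fun _ => RtoC 1)); [|apply Climit_const].
    intro t; cbn [Csum Cpow_nat]; rewrite bincoef_0; ring.
  - replace (RtoC 1) with (Cadd (RtoC 1) (Cmul (bincoef v (S N)) (RtoC 0))) by ring.
    (* Hiding S N makes [cbn] split off the last term only. *)
    remember (S N) as M eqn:EM; cbn [Csum]; apply Climit_add; [exact IH|].
    apply Climit_mul; [apply Climit_const|].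
    assert (H : forall n, Climit (fun t => Cpow_nat (decay c t) (S n)) (RtoC 0)).
    { induction n as [|n IHn]; cbn [Cpow_nat].
      - replace (RtoC 0) with (Cmul (RtoC 1) (RtoC 0)) by ring.
        apply Climit_mul; [apply Climit_const | apply Climit_decay, Hc].
      - replace (RtoC 0) with (Cmul (RtoC 0) (RtoC 0)) by ring.
        apply Climit_mul; [exact IHn | apply Climit_decay, Hc]. }
    subst M; apply H.
Qed.

Definition power_decay (u c : Cx) (x : R) : Cx := Cexp (Cmul u (log_right (one_plus_decay c x))).

Lemma Cderiv_power_decay u c x : 0 < Re c -> 0 <= x ->
  Cderiv (power_decay u c) x
    (Cmul (Cmul u (Cdiv (Cmul (Cmul (RtoC (-2)) c) (decay c x)) (one_plus_decay c x))) (power_decay u c x)).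
Proof.
  intros Hc Hx; apply (Cderiv_exp (fun t => Cmul u (log_right (one_plus_decay c t)))), Cderiv_scale.
  apply Cderiv_log_right; [apply one_plus_decay_pos; assumption | apply Cderiv_one_plus_decay].
Qed.

Lemma Climit_power_decay u c : 0 < Re c -> Climit (power_decay u c) (RtoC 1).
Proof.
  intro Hc; rewrite <- Cexp_0; apply Climit_exp.
  replace (RtoC 0) with (Cmul u (RtoC 0)) by ring; apply Climit_mul; [apply Climit_const|].
  apply Climit_log_right; unfold one_plus_decay.
  replace (RtoC 1) with (Cadd (RtoC 1) (RtoC 0)) at 1 by ring.
  apply Climit_add; [apply Climit_const | apply Climit_decay, Hc].
Qed.

Lemma Cabs_decay_pow c n x : Cabs (Cpow_nat (decay c x) n) = exp (- (2 * Re c * INR n) * x).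
Proof.
  induction n as [|n IH]; cbn [Cpow_nat].
  - rewrite Cabs_RtoC, Rabs_R1, <- exp_0; f_equal; simpl; ring.
  - rewrite Cabs_mul, IH, Cabs_decay, <- exp_plus, S_INR; f_equal; ring.
Qed.

Lemma filterlim_const_bound (f : R -> R) (l B : R) :
  filterlim f (Rbar_locally p_infty) (locally l) -> (exists x0, forall x, x0 <= x -> Rabs (f x) <= B) ->
  Rabs l <= B.
Proof.
  intros Hf [x0 Hx0]; apply Rnot_lt_le; intro Hlt.
  assert (Hp : 0 < Rabs l - B) by lra.
  destruct (Hf (ball l (mkposreal _ Hp)) (locally_ball l (mkposreal _ Hp))) as [M HM].
  set (x := Rmax x0 (M + 1)).
  assert (H1 := Hx0 x (Rmax_l _ _)).
  assert (H2 : ball l (mkposreal _ Hp) (f x)) by (apply HM; unfold x; eapply Rlt_le_trans; [|apply Rmax_r]; lra).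
  unfold ball in H2; simpl in H2; unfold AbsRing_ball, abs, minus, plus, opp in H2; simpl in H2.
  assert (H3 := Rabs_triang_inv l (f x)).
  rewrite <- Rabs_Ropp in H2; replace (- (f x + - l)) with (l - f x) in H2 by ring; lra.
Qed.

Lemma Climit_Cabs_bound f L B :
  Climit f L -> (exists x0, forall x, x0 <= x -> Cabs (f x) <= B) -> Cabs L <= 2 * B.
Proof.
  intros [H1 H2] [x0 H].
  assert (Rabs (Re L) <= B) by (eapply filterlim_const_bound; [exact H1|]; exists x0; intros;
    eapply Rle_trans; [apply Rabs_Re_le | auto]).
  assert (Rabs (Im L) <= B) by (eapply filterlim_const_bound; [exact H2|]; exists x0; intros;
    eapply Rle_trans; [apply Rabs_Im_le | auto]).
  pose proof (Cabs_le_ReIm L); lra.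
Qed.

(** K depends on v and c alone. This uniformity in N and x is what allows N to grow after
    integration. For N = 0 the quotient would tend to 0 instead of 1. *)
Lemma binomial_remainder v c : 0 < Re c ->
  exists K, 0 <= K /\ forall N x, (1 <= N)%nat -> 0 <= x ->
    Cabs (Csub (power_decay (Copp v) c x) (binsum v (decay c x) N))
      <= K * Cabs (bincoef v N) * exp (- (2 * Re c * INR N) * x).
Proof.
  intro Hc.
  destruct (one_plus_decay_bounds c Hc) as (d & Hd & Hdb).
  destruct (power_one_plus_decay_bounded v c Hc) as (M1 & HM1 & HB1).
  destruct (power_one_plus_decay_bounded (Copp v) c Hc) as (M2 & HM2 & HB2).
  (* The derivative of the quotient is at most 2|c| N |b_N| |w|^N M1 / d. With N = mu / (2 Re c)
     this is k |b_N| mu e^(-mu t), the derivative of -k |b_N| e^(-mu t). *)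
  set (k := 2 * Cabs c * M1 / (d * (2 * Re c))).
  assert (Hk : 0 <= k).
  { unfold k; apply Rmult_le_pos; [|left; apply Rinv_0_lt_compat; nra].
    apply Rmult_le_pos; [pose proof (Cabs_ge0 c); lra | lra]. }
  (* One factor 2 comes from the derivative comparison and one from the limit y -> infinity, both by
     splitting into real and imaginary parts. M2 bounds (1+w)^(-v), which turns 1 - Phi back into
     the remainder. *)
  exists (M2 * (4 * k)); split; [nra|].
  intros N x HN Hx; assert (HN0 : 0 < INR N) by (apply lt_0_INR; lia).
  set (mu := 2 * Re c * INR N); assert (Hmu : 0 < mu) by (unfold mu; nra).
  set (Phi := fun t => Cmul (binsum v (decay c t) N) (power_decay v c t)).
  set (Phi' := fun t => Cdiv (Cmul (Cmul (Cmul (RtoC 2) c) (Cmul (RtoC (INR N)) (Cmul (bincoef v N) (Cpow_nat (decay c t) N))))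
           (power_decay v c t)) (one_plus_decay c t)).
  assert (HPhi : forall t, 0 <= t -> Cderiv Phi t (Phi' t)).
  { intros t Ht; eapply Cderiv_eq.
    - apply Cderiv_mul; [apply Cderiv_binsum | apply Cderiv_power_decay; assumption].
    - unfold Phi'.
      replace (Cmul (RtoC (INR N)) (Cmul (bincoef v N) (Cpow_nat (decay c t) N))) with
        (Copp (Cadd (Cmul (one_plus_decay c t) (binsum_diff v (decay c t) N)) (Cmul (Cmul v (decay c t)) (binsum v (decay c t) N))))
        by (unfold one_plus_decay; rewrite binsum_ode; ring).
      replace (RtoC (-2)) with (Copp (RtoC 2)) by (cx; ring).
      field; apply Re_pos_neq0, one_plus_decay_pos; assumption. }
  assert (Hbd : forall t, 0 <= t -> Cabs (Phi' t) <= k * Cabs (bincoef v N) * mu * exp (- mu * t)).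
  { intros t Ht; unfold Phi', Cdiv.
    assert (Hnz : one_plus_decay c t <> RtoC 0) by (apply Re_pos_neq0, one_plus_decay_pos; assumption).
    rewrite !Cabs_mul, Cabs_inv, Cabs_decay_pow, !Cabs_RtoC, (Rabs_pos_eq (INR N)), (Rabs_pos_eq 2) by (assumption || lra).
    fold mu.
    assert (Ha : / Cabs (one_plus_decay c t) <= / d).
    { apply Rinv_le_contravar; [lra|]; eapply Rle_trans; [apply (Hdb t Ht)|].
      eapply Rle_trans; [apply Rle_abs | apply Rabs_Re_le]. }
    assert (Hb := HB1 t Ht); fold (power_decay v c t) in Hb.
    assert (Hi : 0 <= / Cabs (one_plus_decay c t)).
    { left; apply Rinv_0_lt_compat; eapply Rlt_le_trans; [exact (one_plus_decay_pos c t Hc Ht)|].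
      eapply Rle_trans; [apply Rle_abs | apply Rabs_Re_le]. }
    replace (k * Cabs (bincoef v N) * mu * exp (- mu * t))
      with (2 * Cabs c * (INR N * (Cabs (bincoef v N) * exp (- mu * t))) * M1 * / d)
      by (unfold k, mu; field; lra).
    set (q := 2 * Cabs c * (INR N * (Cabs (bincoef v N) * exp (- mu * t)))).
    assert (Hq : 0 <= q).
    { unfold q; assert (H1 := Cabs_ge0 c); assert (H2 := Cabs_ge0 (bincoef v N)); assert (H3 := exp_pos (- mu * t)).
      repeat apply Rmult_le_pos; lra. }
    apply Rmult_le_compat; try assumption; [apply Rmult_le_pos; [exact Hq | apply Cabs_ge0]|].
    apply Rmult_le_compat_l; assumption. }
  assert (Hinc : forall y, x <= y -> Cabs (Csub (Phi y) (Phi x)) <= 2 * (k * Cabs (bincoef v N) * exp (- mu * x))).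
  { intros y Hy; eapply Rle_trans.
    - apply (Cderiv_dominated Phi Phi' (fun t => - (k * Cabs (bincoef v N)) * exp (- mu * t))
              (fun t => k * Cabs (bincoef v N) * mu * exp (- mu * t)) x y Hy).
      + intros t Ht; apply HPhi; lra.
      + intros t _; auto_derive; [exact I | ring].
      + intros t Ht; apply Hbd; lra.
    - assert (H1 := exp_pos (- mu * y)).
      assert (H2 := Rmult_le_pos _ _ Hk (Cabs_ge0 (bincoef v N))); nra. }
  assert (HlimPhi : Climit (fun y => Csub (Phi y) (Phi x)) (Csub (RtoC 1) (Phi x))).
  { apply Climit_add; [|apply Climit_const].
    replace (RtoC 1) with (Cmul (RtoC 1) (RtoC 1)) by ring; apply Climit_mul.
    - destruct N as [|N]; [lia|]; apply Climit_binsum, Hc.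
    - apply Climit_power_decay, Hc. }
  assert (H1 : Cabs (Csub (RtoC 1) (Phi x)) <= 2 * (2 * (k * Cabs (bincoef v N) * exp (- mu * x)))).
  { apply (Climit_Cabs_bound _ _ _ HlimPhi); exists x; exact Hinc. }
  replace (Csub (power_decay (Copp v) c x) (binsum v (decay c x) N))
    with (Cmul (power_decay (Copp v) c x) (Csub (RtoC 1) (Phi x))).
  - rewrite Cabs_mul; assert (H2 := HB2 x Hx); fold (power_decay (Copp v) c x) in H2.
    replace (M2 * (4 * k) * Cabs (bincoef v N) * exp (- mu * x))
      with (M2 * (2 * (2 * (k * Cabs (bincoef v N) * exp (- mu * x))))) by ring.
    apply Rmult_le_compat; try apply Cabs_ge0; assumption.
  - unfold Phi, power_decay.
    set (L := log_right _).
    replace (Cmul (Copp v) L) with (Copp (Cmul v L)) by ring.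
    rewrite Cexp_opp; field; apply Cexp_neq0.
Qed.

(** * Termwise integration *)

Lemma Ccontinuous_ext f g x : (forall t, f t = g t) -> Ccontinuous f x -> Ccontinuous g x.
Proof.
  intros E [H1 H2]; split; [apply (continuous_ext (fun t => Re (f t))) | apply (continuous_ext (fun t => Im (f t)))];
    try assumption; intro; rewrite E; reflexivity.
Qed.

Lemma Climit_Cabs f L : Climit f L -> forall eps, 0 < eps ->
  exists M, 0 <= M /\ forall x, M <= x -> Cabs (Csub (f x) L) <= eps.
Proof.
  intros [H1 H2] eps Heps.
  assert (Hp : 0 < eps / 2) by lra.
  destruct (H1 (ball (Re L) (mkposreal _ Hp)) (locally_ball _ (mkposreal _ Hp))) as [M1 HM1].
  destruct (H2 (ball (Im L) (mkposreal _ Hp)) (locally_ball _ (mkposreal _ Hp))) as [M2 HM2].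
  exists (Rmax 0 (Rmax (M1 + 1) (M2 + 1))); split; [apply Rmax_l|].
  intros x Hx.
  assert (Hx' : Rmax (M1 + 1) (M2 + 1) <= x) by (eapply Rle_trans; [apply Rmax_r | exact Hx]).
  assert (A1 : Rabs (Re (f x) - Re L) < eps / 2).
  { apply (HM1 x); eapply Rlt_le_trans; [|eapply Rle_trans; [apply Rmax_l | exact Hx']]; lra. }
  assert (A2 : Rabs (Im (f x) - Im L) < eps / 2).
  { apply (HM2 x); eapply Rlt_le_trans; [|eapply Rle_trans; [apply Rmax_r | exact Hx']]; lra. }
  pose proof (Cabs_le_ReIm (Csub (f x) L)) as H; simpl in H; unfold Rminus in *; lra.
Qed.

Lemma Csub_triangle x y z : Cabs (Csub x z) <= Cabs (Csub x y) + Cabs (Csub y z).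
Proof. replace (Csub x z) with (Cadd (Csub x y) (Csub y z)) by ring; apply Cabs_add. Qed.

Lemma Cabs_sub_sym x y : Cabs (Csub x y) = Cabs (Csub y x).
Proof. replace (Csub x y) with (Copp (Csub y x)) by ring; apply Cabs_opp. Qed.

Lemma Cx_complete (s : nat -> Cx) :
  (forall eps, 0 < eps -> exists N0, forall N M, (N0 <= N)%nat -> (N0 <= M)%nat -> Cabs (Csub (s N) (s M)) < eps) ->
  exists J, forall eps, 0 < eps -> exists N0, forall N, (N0 <= N)%nat -> Cabs (Csub (s N) J) < eps.
Proof.
  intros H.
  destruct (R_complete (fun n => Re (s n))) as [x Hx].
  { intros eps Heps; destruct (H eps Heps) as [N0 HN]; exists N0; intros n m Hn Hm.
    eapply Rle_lt_trans; [apply (Rabs_Re_le (Csub (s n) (s m))) | apply HN; assumption]. }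
  destruct (R_complete (fun n => Im (s n))) as [y Hy].
  { intros eps Heps; destruct (H eps Heps) as [N0 HN]; exists N0; intros n m Hn Hm.
    eapply Rle_lt_trans; [apply (Rabs_Im_le (Csub (s n) (s m))) | apply HN; assumption]. }
  exists (mkC x y); intros eps Heps.
  assert (Hp : eps / 2 > 0) by lra.
  destruct (Hx _ Hp) as [N1 HN1]; destruct (Hy _ Hp) as [N2 HN2].
  exists (N1 + N2)%nat; intros N HN.
  assert (A1 := HN1 N ltac:(lia)); assert (A2 := HN2 N ltac:(lia)).
  pose proof (Cabs_le_ReIm (Csub (s N) (mkC x y))) as A3; simpl in A3.
  unfold Rdist, Rminus in *; lra.
Qed.

(** For mu proportional to N the leading term C0 / mu^2 carries the gain N^(-2) obtained from the
    vanishing of the kernel at 0. *)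
Lemma is_RInt_linear_exp C0 mu T : 0 < mu ->
  is_RInt (fun x => C0 * x * exp (- mu * x)) 0 T (C0 / (mu * mu) - C0 * (T / mu + / (mu * mu)) * exp (- mu * T)).
Proof.
  intro Hmu.
  evar (l : R); enough (H : is_RInt (fun x => C0 * x * exp (- mu * x)) 0 T l).
  { unfold l in H; eapply eq_ind; [exact H|].
    instantiate (1 := minus (- C0 * (T / mu + / (mu * mu)) * exp (- mu * T)) (- C0 * (0 / mu + / (mu * mu)) * exp (- mu * 0))).
    unfold minus, plus, opp; simpl; rewrite Rmult_0_r, exp_0; field; lra. }
  apply (is_RInt_derive (fun x => - C0 * (x / mu + / (mu * mu)) * exp (- mu * x))).
  - intros x _; auto_derive; [exact I|]; field; lra.
  - intros x _; apply (@ex_derive_continuous R_AbsRing R_NormedModule); auto_derive; exact I.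
Qed.

(** The same J is the sum of the series and the limit of the integrals. Integrals enter as arbitrary
    values L of [CInt], so that the result can be applied to any integral computed elsewhere. *)
Lemma termwise_integration v c g t K :
  Re v < 3 -> 0 < Re c -> 0 <= K -> (forall x, 0 <= x -> Cabs (g x) <= K * x) ->
  (forall n, improper (fun x => Cmul (g x) (Cpow_nat (decay c x) n)) (t n)) ->
  exists J, series_converges_to (fun n => Cmul (bincoef v n) (t n)) J /\
    forall eps, 0 < eps -> exists M, 0 <= M /\ forall T L, M <= T ->
      CInt (fun x => Cmul (g x) (power_decay (Copp v) c x)) 0 T L -> Cabs (Csub L J) < eps.
Proof.
  intros Hv Hc HK Hg Ht.
  set (s := Csum (fun n => Cmul (bincoef v n) (t n))).
  assert (Hs : forall N, improper (fun x => Cmul (g x) (binsum v (decay c x) N)) (s N)).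
  { induction N as [|N IH].
    - apply (improper_ext (fun x => Cmul (RtoC 0) (Cmul (g x) (Cpow_nat (decay c x) 0))) _ (Cmul (RtoC 0) (t 0%nat))).
      + intro; unfold binsum; cbn [Csum]; ring.
      + unfold s; cbn [Csum]; ring.
      + apply improper_scale, Ht.
    - eapply improper_ext; [| | apply improper_add; [exact IH | apply (improper_scale (bincoef v N)), (Ht N)]].
      + intro; unfold binsum; cbn [Csum]; cbv beta; ring.
      + reflexivity. }
  assert (Hcont : forall x, 0 <= x -> Ccontinuous (fun x => Cmul (g x) (power_decay (Copp v) c x)) x).
  { intros x Hx; apply Ccontinuous_mul.
    - destruct (Ht 0%nat) as (_ & _ & Hc0 & _); eapply Ccontinuous_ext; [|apply Hc0].
      intro; cbn [Cpow_nat]; ring.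
    - eapply Cderiv_continuous, Cderiv_power_decay; assumption. }
  destruct (binomial_remainder v c Hc) as (K' & HK' & Hrem).
  (* T0 depends on N because the tail of the integrated partial sum must be small; the contribution
     of the remainder is bounded for all T >= 0 at once. *)
  assert (key : forall eps, 0 < eps -> exists N0, forall N, (N0 <= N)%nat -> exists T0, 0 <= T0 /\
    forall T L, T0 <= T -> CInt (fun x => Cmul (g x) (power_decay (Copp v) c x)) 0 T L -> Cabs (Csub L (s N)) <= eps).
  { intros eps Heps.
    assert (Hkk : 0 <= K * K') by (apply Rmult_le_pos; assumption).
    (* Chosen so that |b_N| <= e' N^2 and mu = 2 Re(c) N give 2 C0 / mu^2 <= eps/2; adding 1 to K K'
       covers the case K K' = 0. *)
    set (e' := eps / 2 * (2 * Re c * (2 * Re c)) / (2 * (K * K' + 1))).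
    assert (He' : 0 < e') by (apply Rdiv_lt_0_compat; [apply Rmult_lt_0_compat; nra | lra]).
    destruct (bincoef_growth v Hv e' He') as [N0 HN0].
    exists (S N0); intros N HN; specialize (HN0 N ltac:(lia)).
    destruct (Hs N) as (A & A1 & A2 & A3 & A4).
    assert (Heps2 : 0 < eps / 2) by lra.
    destruct (Climit_Cabs A _ A3 _ Heps2) as (T0 & HT0 & HA); exists T0; split; [exact HT0|].
    intros T L HT HL; specialize (HA T HT).
    assert (HN1 : 0 < INR N) by (apply lt_0_INR; lia).
    set (mu := 2 * Re c * INR N).
    assert (Hmu : 0 < mu) by (unfold mu; nra).
    assert (HT1 : 0 <= T) by lra.
    set (C0 := K * (K' * Cabs (bincoef v N))).
    assert (HC0 : 0 <= C0).
    { unfold C0; apply Rmult_le_pos; [assumption|]; apply Rmult_le_pos; [assumption | apply Cabs_ge0]. }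
    assert (HI : Cabs (Csub L (Csub (A T) (A 0))) <= 2 * (C0 / (mu * mu) - C0 * (T / mu + / (mu * mu)) * exp (- mu * T))).
    { apply (CInt_bound (fun x => Csub (Cmul (g x) (power_decay (Copp v) c x)) (Cmul (g x) (binsum v (decay c x) N)))
               (fun x => C0 * x * exp (- mu * x)) 0 T); [assumption | | | apply is_RInt_linear_exp, Hmu].
      - intros x Hx.
        replace (Csub _ _) with (Cmul (g x) (Csub (power_decay (Copp v) c x) (binsum v (decay c x) N))) by ring.
        rewrite Cabs_mul; specialize (Hrem N x ltac:(lia) (proj1 Hx)); specialize (Hg x (proj1 Hx)).
        unfold C0; replace (K * (K' * Cabs (bincoef v N)) * x * exp (- mu * x))
          with ((K * x) * (K' * Cabs (bincoef v N) * exp (- mu * x))) by ring.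
        apply Rmult_le_compat; try apply Cabs_ge0; assumption.
      - apply CInt_sub; [exact HL|].
        apply (CInt_deriv (fun x => Cmul (g x) (binsum v (decay c x) N))); intros; [apply A1 | apply A2]. }
    assert (HB : 2 * (C0 / (mu * mu)) <= eps / 2).
    { assert (Hb : C0 <= (K * K') * (e' * (INR N * INR N))).
      { unfold C0; rewrite <- Rmult_assoc; apply Rmult_le_compat_l; assumption. }
      assert (Hm : 0 < mu * mu) by nra.
      apply (Rmult_le_reg_r (mu * mu)); [exact Hm|].
      replace (2 * (C0 / (mu * mu)) * (mu * mu)) with (2 * C0) by (field; lra).
      assert (E : eps / 2 * (mu * mu) = 2 * ((K * K' + 1) * (e' * (INR N * INR N)))) by (unfold e', mu; field; lra).
      rewrite E; apply Rmult_le_compat_l; [lra|]; eapply Rle_trans; [exact Hb|].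
      apply Rmult_le_compat_r; [|lra]; apply Rmult_le_pos; [lra | nra]. }
    assert (Hpos : 0 <= C0 * (T / mu + / (mu * mu)) * exp (- mu * T)).
    { apply Rmult_le_pos; [|left; apply exp_pos]; apply Rmult_le_pos; [assumption|].
      assert (0 < / (mu * mu)) by (apply Rinv_0_lt_compat; nra).
      assert (0 <= T / mu) by (apply Rmult_le_pos; [assumption | left; apply Rinv_0_lt_compat; assumption]); lra. }
    eapply Rle_trans; [apply (Csub_triangle _ (Csub (A T) (A 0)))|].
    replace (Csub (Csub (A T) (A 0)) (s N)) with (Csub (A T) (RtoC 0)) by (rewrite <- A4; ring).
    lra. }
  (* The partial sums are Cauchy since any two of them with large index are close to one and the
     same integral, taken up to the larger of their two thresholds. *)
  destruct (Cx_complete s) as [J HJ].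
  { intros eps Heps; destruct (key (eps / 3) ltac:(lra)) as [N0 HN0]; exists N0; intros N M HN HM.
    destruct (HN0 N HN) as (T1 & HT1 & H1); destruct (HN0 M HM) as (T2 & HT2 & H2).
    destruct (CInt_continuous (fun x => Cmul (g x) (power_decay (Copp v) c x)) 0 (Rmax T1 T2)) as [L HL].
    { intros x Hx; apply Hcont; rewrite Rmin_left in Hx; [apply Hx|].
      eapply Rle_trans; [exact HT1 | apply Rmax_l]. }
    specialize (H1 _ L (Rmax_l T1 T2) HL); specialize (H2 _ L (Rmax_r T1 T2) HL).
    eapply Rle_lt_trans; [apply (Csub_triangle _ L)|]; rewrite (Cabs_sub_sym (s N)); lra. }
  exists J; split; [exact HJ|].
  intros eps Heps; destruct (key (eps / 2) ltac:(lra)) as [N1 HN1]; destruct (HJ (eps / 2) ltac:(lra)) as [N2 HN2].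
  destruct (HN1 (N1 + N2)%nat ltac:(lia)) as (M & HM & H1); specialize (HN2 (N1 + N2)%nat ltac:(lia)).
  exists M; split; [exact HM|]; intros T L HT HL; specialize (H1 T L HT HL).
  eapply Rle_lt_trans; [apply (Csub_triangle _ (s (N1 + N2)%nat))|]; lra.
Qed.

(** * Integrability across the branch cut *)

Lemma exp_log_right z : 0 < Re z -> Cexp (log_right z) = z.
Proof.
  intro Hz; unfold log_right.
  assert (Hn : 0 < Cnorm2 z) by (unfold Cnorm2; nra).
  assert (Ha : 0 < Cabs z) by (apply sqrt_lt_R0, Hn).
  assert (E : sqrt (1 + (Im z / Re z)²) = Cabs z / Re z).
  { apply sqrt_lem_1; [pose proof (Rle_0_sqr (Im z / Re z)); lra | left; apply Rdiv_lt_0_compat; assumption |].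
    replace (Cabs z / Re z * (Cabs z / Re z)) with (Cabs z * Cabs z / (Re z * Re z)) by (field; lra).
    unfold Cabs; rewrite sqrt_sqrt by lra; unfold Cnorm2, Rsqr; field; lra. }
  cx; rewrite exp_ln, ?cos_atan, ?sin_atan, E by assumption; field; lra.
Qed.

(** Identifies a logarithm found by other means as the principal one: it remains to place its
    imaginary part strictly between -PI and PI. *)
Lemma Carg_unique z rho theta :
  0 < rho -> - PI < theta < PI -> Re z = rho * cos theta -> Im z = rho * sin theta -> Carg z = theta.
Proof.
  intros Hrho Ht HR HI; assert (HP := PI_RGT_0).
  assert (Hdiv : cos theta <> 0 -> Im z / Re z = tan theta) by (intro; rewrite HR, HI; unfold tan; field; lra).
  unfold Carg.
  destruct (Rlt_le_dec theta (- (PI / 2))) as [H1|H1]; [|destruct (Rle_lt_or_eq_dec _ _ H1) as [H2|<-]; clear H1;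
    [destruct (Rlt_le_dec theta (PI / 2)) as [H3|H3]; [|destruct (Rle_lt_or_eq_dec _ _ H3) as [H4| <-]; clear H3]|]].
  - assert (Hcos : cos theta < 0) by (rewrite <- cos_neg; apply cos_lt_0; lra).
    assert (Hsin : sin theta < 0) by (apply sin_lt_0_var; lra).
    destruct (Rlt_dec 0 (Re z)); [nra|]; destruct (Rlt_dec (Re z) 0); [|nra].
    destruct (Rle_dec 0 (Im z)); [nra|].
    rewrite Hdiv by lra; replace (tan theta) with (tan (theta + PI))
      by (unfold tan; rewrite neg_sin, neg_cos; field; lra).
    rewrite atan_tan by lra; ring.
  - assert (Hcos : 0 < cos theta) by (apply cos_gt_0; lra).
    destruct (Rlt_dec 0 (Re z)); [|nra]; rewrite Hdiv by lra; apply atan_tan; lra.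
  - assert (Hcos : cos theta < 0) by (apply cos_lt_0; lra).
    assert (Hsin : 0 < sin theta) by (apply sin_gt_0; lra).
    destruct (Rlt_dec 0 (Re z)); [nra|]; destruct (Rlt_dec (Re z) 0); [|nra].
    destruct (Rle_dec 0 (Im z)); [|nra].
    rewrite Hdiv by lra; replace (tan theta) with (tan (theta - PI)).
    + rewrite atan_tan by lra; ring.
    + replace (tan theta) with (tan ((theta - PI) + PI)) by (f_equal; ring).
      assert (cos (theta - PI) <> 0).
      { replace theta with ((theta - PI) + PI) in Hcos by ring; rewrite neg_cos in Hcos; lra. }
      unfold tan; rewrite neg_sin, neg_cos; field; assumption.
  - rewrite cos_PI2, Rmult_0_r in HR; rewrite sin_PI2 in HI.
    destruct (Rlt_dec 0 (Re z)); [lra|]; destruct (Rlt_dec (Re z) 0); [lra|].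
    destruct (Rlt_dec 0 (Im z)); lra.
  - rewrite cos_neg, cos_PI2, Rmult_0_r in HR; rewrite sin_neg, sin_PI2 in HI.
    destruct (Rlt_dec 0 (Re z)); [lra|]; destruct (Rlt_dec (Re z) 0); [lra|].
    destruct (Rlt_dec 0 (Im z)); [lra|]; destruct (Rlt_dec (Im z) 0); lra.
Qed.

Lemma cos_sin_period_Z x (m : Z) : cos (x + 2 * IZR m * PI) = cos x /\ sin (x + 2 * IZR m * PI) = sin x.
Proof.
  destruct (Z_le_gt_dec 0 m) as [Hm | Hm].
  - rewrite <- (Z2Nat.id m Hm), <- INR_IZR_INZ; split; [apply cos_period | apply sin_period].
  - set (y := x + 2 * IZR m * PI).
    replace x with (y + 2 * INR (Z.to_nat (- m)) * PI).
    + rewrite cos_period, sin_period; split; reflexivity.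
    + unfold y; rewrite INR_IZR_INZ, Z2Nat.id, opp_IZR by lia; ring.
Qed.

(* For x < 0 the identity 1 + w = w (1 + 1/w) gives logarithms of 1 + w that are continuous across the cut. *)
Definition left_branch (c : Cx) (m : Z) (x : R) : Cx :=
  Cadd (Cadd (Cmul (RtoC (-2)) (Cmul c (RtoC x))) (mkC 0 (- (2 * IZR m * PI)))) (log_right (one_plus_decay (Copp c) x)).

Lemma one_plus_decay_opp_pos c x : 0 < Re c -> x <= 0 -> 0 < Re (one_plus_decay (Copp c) x).
Proof.
  intros Hc Hx; replace (one_plus_decay (Copp c) x) with (one_plus_decay c (- x)).
  - apply one_plus_decay_pos; lra.
  - unfold one_plus_decay, decay; do 3 f_equal; rewrite RtoC_opp; ring.
Qed.

(** The candidate is a logarithm of w (1 + 1/w), with imaginary part phi + al. Here phi is the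
    argument of w reduced by m turns and al is the argument of 1 + 1/w, which is zero or opposite in
    sign to phi and smaller than PI/2 in modulus. Hence phi + al stays inside (-PI, PI). *)
Lemma Clog_left_branch c m x :
  0 < Re c -> x <= 0 -> - PI < - 2 * Im c * x - 2 * IZR m * PI < PI ->
  Clog (one_plus_decay c x) = left_branch c m x.
Proof.
  intros Hc Hx Hphi.
  assert (Hp := one_plus_decay_opp_pos c x Hc Hx).
  set (z' := one_plus_decay (Copp c) x) in *.
  assert (Ez : one_plus_decay c x = Cmul (decay c x) z').
  { unfold z', one_plus_decay.
    assert (H : Cmul (decay c x) (decay (Copp c) x) = RtoC 1).
    { unfold decay; rewrite <- Cexp_add, <- Cexp_0; f_equal; ring. }
    transitivity (Cadd (decay c x) (Cmul (decay c x) (decay (Copp c) x))); [rewrite H|]; ring. }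
  set (phi := - 2 * Im c * x - 2 * IZR m * PI) in *.
  set (al := atan (Im z' / Re z')).
  assert (Hper := cos_sin_period_Z phi m).
  assert (Eexp : one_plus_decay c x = Cexp (left_branch c m x)).
  { rewrite Ez; unfold left_branch; fold z'; rewrite !Cexp_add, exp_log_right by assumption.
    replace (Cexp (mkC 0 (- (2 * IZR m * PI)))) with (RtoC 1); [unfold decay; ring|].
    destruct (cos_sin_period_Z (- (2 * IZR m * PI)) m) as [H1 H2].
    replace (- (2 * IZR m * PI) + 2 * IZR m * PI) with 0 in * by ring.
    cx; rewrite exp_0, <- ?H1, <- ?H2, ?cos_0, ?sin_0; ring. }
  assert (Him : Im (left_branch c m x) = phi + al).
  { change (Im (Cadd (Cmul (RtoC (-2)) (Cmul c (RtoC x))) (mkC 0 (- (2 * IZR m * PI)))) + al = phi + al).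
    f_equal; unfold phi; simpl; ring. }
  assert (Hy : Im z' = exp (2 * Re c * x) * - sin phi).
  { unfold z', one_plus_decay, decay; simpl.
    match goal with |- _ + exp ?u * sin ?w = _ =>
      replace u with (2 * Re c * x) by ring; replace w with (- (phi + 2 * IZR m * PI)) by (unfold phi; ring) end.
    rewrite sin_neg, (proj2 Hper); ring. }
  assert (Hal : - PI < phi + al < PI).
  { assert (Hb := atan_bound (Im z' / Re z')); fold al in Hb.
    assert (Hi : 0 < / Re z') by (apply Rinv_0_lt_compat, Hp).
    assert (He := exp_pos (2 * Re c * x)).
    destruct (Rle_lt_dec 0 phi) as [Hs | Hs].
    - assert (0 <= sin phi) by (apply sin_ge_0; lra).
      assert (Im z' / Re z' <= 0) by (unfold Rdiv; rewrite Hy; assert (0 <= exp (2 * Re c * x) * sin phi) by nra; nra).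
      assert (al <= 0).
      { rewrite <- atan_0; destruct (Rle_lt_or_eq_dec _ _ H0) as [Hl | He0];
          [left; apply atan_increasing, Hl | unfold al; rewrite He0; apply Rle_refl]. }
      lra.
    - assert (sin phi < 0) by (apply sin_lt_0_var; lra).
      assert (0 < Im z' / Re z') by (unfold Rdiv; rewrite Hy; assert (0 < exp (2 * Re c * x) * - sin phi) by nra; nra).
      assert (0 < al) by (rewrite <- atan_0; apply atan_increasing; assumption).
      lra. }
  apply Cx_eq.
  - unfold Clog; cbn [Re]; rewrite Eexp, Cabs_exp, ln_exp; reflexivity.
  - unfold Clog; cbn [Im]; rewrite Him.
    apply (Carg_unique _ (exp (Re (left_branch c m x)))); [apply exp_pos | exact Hal | |];
      rewrite Eexp, <- Him; reflexivity.
Qed.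

Lemma Ccontinuous_left_branch c m x : 0 < Re c -> x <= 0 -> Ccontinuous (left_branch c m) x.
Proof.
  intros Hc Hx; apply Ccontinuous_add.
  - apply Ccontinuous_add; [|apply Ccontinuous_const].
    eapply Cderiv_continuous, Cderiv_scale, Cderiv_scale, Cderiv_RtoC.
  - eapply Cderiv_continuous, Cderiv_log_right; [apply one_plus_decay_opp_pos; assumption | apply Cderiv_one_plus_decay].
Qed.

Lemma Ccontinuous_exp f x : Ccontinuous f x -> Ccontinuous (fun t => Cexp (f t)) x.
Proof.
  intros [H1 H2].
  assert (He : continuous (fun t => exp (Re (f t))) x)
    by (apply (continuous_comp (fun t => Re (f t)) exp); [exact H1 | apply continuous_exp]).
  split; simpl; apply (@continuous_mult R_UniformSpace R_AbsRing); try exact He.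
  - apply (continuous_comp (fun t => Im (f t)) cos); [exact H2 | apply continuous_cos].
  - apply (continuous_comp (fun t => Im (f t)) sin); [exact H2 | apply continuous_sin].
Qed.

(** Between consecutive points where w meets the negative real axis the integrand agrees with a
    function continuous up to the end points. Finitely many such pieces cover [u, 0]. *)
Lemma CInt_left h z c u : 0 < Re c -> (forall x, Ccontinuous h x) -> u <= 0 ->
  exists L, CInt (fun x => Cmul (h x) (Cexp (Cmul z (Clog (one_plus_decay c x))))) u 0 L.
Proof.
  intros Hc Hh Hu.
  set (f := fun x => Cmul (h x) (Cexp (Cmul z (Clog (one_plus_decay c x))))).
  assert (HP := PI_RGT_0).
  assert (piece : forall m a b, a <= b <= 0 ->
    (forall x, a < x < b -> - PI < - 2 * Im c * x - 2 * IZR m * PI < PI) -> exists L, CInt f a b L).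
  { intros m a b Hab Hx.
    destruct (CInt_continuous (fun x => Cmul (h x) (Cexp (Cmul z (left_branch c m x)))) a b) as [L HL].
    { intros x Hx'; rewrite Rmin_left, Rmax_right in Hx' by lra.
      apply Ccontinuous_mul; [apply Hh|]; apply Ccontinuous_exp, Ccontinuous_mul;
        [apply Ccontinuous_const | apply Ccontinuous_left_branch; lra]. }
    (* Equality is required only inside the interval: at an end point w may be a negative real,
       where [Clog] and [left_branch] can differ by a full turn. *)
    exists L; eapply CInt_ext; [|exact HL].
    intros x Hx'; rewrite Rmin_left, Rmax_right in Hx' by lra.
    unfold f; rewrite (Clog_left_branch c m x) by (try apply Hx; lra); reflexivity. }
  assert (main : forall n u, u <= 0 -> 2 * Rabs (Im c) * - u <= (2 * INR n + 1) * PI -> exists L, CInt f u 0 L).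
  { clear u Hu; assert (Ha := Rabs_pos (Im c)).
    induction n as [|n IH]; intros u Hu Hn.
    - apply (piece 0%Z); [lra|]; intros x Hx; simpl in Hn |- *.
      destruct (Req_dec (Im c) 0) as [E0 | E0]; [rewrite E0; lra|].
      assert (0 < Rabs (Im c)) by (apply Rabs_pos_lt, E0).
      assert (Rabs (Im c) * - x < Rabs (Im c) * - u) by (apply Rmult_lt_compat_l; lra).
      destruct (Rcase_abs (Im c)); [rewrite Rabs_left in * by assumption | rewrite Rabs_right in * by assumption]; nra.
    - destruct (Rle_lt_dec (2 * Rabs (Im c) * - u) ((2 * INR n + 1) * PI)) as [Hle | Hlt]; [apply IH; assumption|].
      rewrite S_INR in Hn; assert (Hp := pos_INR n).
      assert (Hd : 0 < Rabs (Im c)).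
      { destruct (Rle_lt_or_eq_dec _ _ Ha) as [|E0]; [assumption|]; rewrite <- E0 in Hlt; nra. }
      (* Going left from 0, w meets the negative real axis here for the (n+1)-st time. *)
      set (u' := - ((2 * INR n + 1) * PI / (2 * Rabs (Im c)))).
      assert (Eu' : 2 * Rabs (Im c) * - u' = (2 * INR n + 1) * PI) by (unfold u'; field; lra).
      assert (Hu' : u <= u' <= 0) by (split; nra).
      destruct (IH u') as [L1 HL1]; [lra | lra |].
      (* As x < 0, the angle -2 Im(c) x has the sign of Im c; on this piece it lies within PI of 2 m
         PI with |m| = n + 1. *)
      destruct (piece (if Rlt_dec 0 (Im c) then Z.of_nat (S n) else (- Z.of_nat (S n))%Z) u u' Hu') as [L2 HL2].
      + intros x Hx.
        assert (Rabs (Im c) * - x < Rabs (Im c) * - u) by (apply Rmult_lt_compat_l; lra).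
        assert (Rabs (Im c) * - u' < Rabs (Im c) * - x) by (apply Rmult_lt_compat_l; lra).
        destruct (Rlt_dec 0 (Im c));
          [rewrite Rabs_right in * by lra | rewrite Rabs_left1 in * by lra; rewrite opp_IZR];
          rewrite <- INR_IZR_INZ, S_INR; nra.
      + exists (Cadd L2 L1); eapply CInt_Chasles; eassumption. }
  destruct (INR_unbounded (2 * Rabs (Im c) * - u / PI)) as [n Hn].
  apply (main n u Hu).
  apply (Rmult_lt_compat_r PI) in Hn; [|lra].
  replace (2 * Rabs (Im c) * - u / PI * PI) with (2 * Rabs (Im c) * - u) in Hn by (field; lra).
  assert (0 <= INR n * PI) by (apply Rmult_le_pos; [apply pos_INR | lra]); lra.
Qed.

(** * The kernel and the hypergeometric terms *)

Definition expl (q : Cx) (x : R) : Cx := Cexp (Cmul (Copp q) (RtoC x)).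

Definition shift (c : Cx) (n : nat) (q : Cx) : Cx := Cadd q (Cmul (RtoC (2 * INR n)) c).

Lemma shift_0 c q : shift c 0 q = q.
Proof. cx; ring. Qed.

Lemma Re_shift_pos c n q : 0 < Re c -> 0 < Re q -> 0 < Re (shift c n q).
Proof. intros Hc Hq; simpl; assert (H := pos_INR n); nra. Qed.

Lemma expl_shift c n q x : Cmul (expl q x) (Cpow_nat (decay c x) n) = expl (shift c n q) x.
Proof.
  assert (H : Cpow_nat (decay c x) n = expl (Cmul (RtoC (2 * INR n)) c) x).
  { induction n as [|n IH]; cbn [Cpow_nat].
    - unfold expl; rewrite <- Cexp_0; f_equal; cx; ring.
    - rewrite IH; unfold expl, decay; rewrite <- Cexp_add; f_equal; rewrite S_INR; cx; ring. }
  rewrite H; unfold expl, shift; rewrite <- Cexp_add; f_equal; ring.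
Qed.

Lemma Cabs_expl_le1 q x : 0 < Re q -> 0 <= x -> Cabs (expl q x) <= 1.
Proof.
  intros Hq Hx; unfold expl; rewrite Cabs_expl, <- exp_0.
  destruct (Req_dec x 0) as [->|]; [right; f_equal; ring | left; apply exp_increasing; nra].
Qed.

Lemma RtoC_half : RtoC (/ 2) = Cinv (RtoC 2).
Proof. cx; unfold Cnorm2; simpl; field. Qed.

Lemma RtoC2_neq0 : RtoC 2 <> RtoC 0.
Proof. apply RtoC_neq0; lra. Qed.

(** The Laplace transform of sinh(ax) cosh(bx) at vc + 2nc, divided by a; in this closed form it
    still makes sense at a = 0. *)
Definition laplace_value (v a b c : Cx) (n : nat) : Cx :=
  Cdiv (Csub (Cmul (shift c n (Cmul v c)) (shift c n (Cmul v c))) (Csub (Cmul a a) (Cmul b b)))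
    (Cmul (Cmul (Cmul (shift c n (Csub (Csub (Cmul v c) a) b)) (shift c n (Cadd (Cadd (Cmul v c) a) b)))
       (shift c n (Cadd (Csub (Cmul v c) a) b))) (shift c n (Csub (Cadd (Cmul v c) a) b))).

(* The kernel g is sinh(ax) cosh(bx) e^(-vcx) divided by a, with its limit as a tends to 0 when a = 0:
   the hypergeometric series must be shown to converge in that case too. *)
Lemma kernel_exists (v a b c : Cx) :
  0 < Re c ->
  0 < Re (Cadd (Cadd (Cmul v c) a) b) -> 0 < Re (Csub (Cadd (Cmul v c) a) b) ->
  0 < Re (Cadd (Csub (Cmul v c) a) b) -> 0 < Re (Csub (Csub (Cmul v c) a) b) ->
  exists g K, 0 <= K /\ (forall x, 0 <= x -> Cabs (g x) <= K * x) /\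
    (forall x, Cmul (Cmul (Csinh (Cmul a (RtoC x))) (Ccosh (Cmul b (RtoC x)))) (expl (Cmul v c) x) = Cmul a (g x)) /\
    (forall n, improper (fun x => Cmul (g x) (Cpow_nat (decay c x) n)) (laplace_value v a b c n)).
Proof.
  intros Hc H2 H4 H3 H1.
  assert (H20 := RtoC2_neq0).
  destruct (Req_dec (Cabs a) 0) as [Ea | Ea].
  - assert (E : a = RtoC 0).
    { pose proof (Rabs_Re_le a) as A1; pose proof (Rabs_Im_le a) as A2; rewrite Ea in *.
      apply Rabs_le_between in A1; apply Rabs_le_between in A2; cx; lra. }
    subst a; clear Ea.
    replace (Csub (Csub (Cmul v c) (RtoC 0)) b) with (Csub (Cmul v c) b) in * by ring.
    replace (Cadd (Cadd (Cmul v c) (RtoC 0)) b) with (Cadd (Cmul v c) b) in * by ring.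
    set (qm := Csub (Cmul v c) b) in *; set (qp := Cadd (Cmul v c) b) in *.
    exists (fun x => Cmul (RtoC x) (Cmul (Cinv (RtoC 2)) (Cadd (expl qm x) (expl qp x)))), 1.
    split; [lra|]; split; [|split].
    + intros x Hx; rewrite !Cabs_mul, Cabs_RtoC, Rabs_pos_eq, Cabs_inv, Cabs_RtoC, (Rabs_pos_eq 2) by (assumption || lra).
      assert (A1 := Cabs_add (expl qm x) (expl qp x)).
      assert (A2 := Cabs_expl_le1 qm x H1 Hx); assert (A3 := Cabs_expl_le1 qp x H2 Hx); nra.
    + intro x; unfold Csinh; replace (Cmul (RtoC 0) (RtoC x)) with (RtoC 0) by ring.
      replace (Copp (RtoC 0)) with (RtoC 0) by ring; ring.
    + intro n.
      assert (N1 := Re_pos_neq0 _ (Re_shift_pos c n qm Hc H1)).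
      assert (N2 := Re_pos_neq0 _ (Re_shift_pos c n qp Hc H2)).
      apply (improper_ext (fun x => Cmul (Cinv (RtoC 2)) (Cadd (Cmul (RtoC x) (expl (shift c n qm) x)) (Cmul (RtoC x) (expl (shift c n qp) x))))
        _ (Cmul (Cinv (RtoC 2)) (Cadd (Cmul (Cinv (shift c n qm)) (Cinv (shift c n qm)))
             (Cmul (Cinv (shift c n qp)) (Cinv (shift c n qp)))))).
      * intro x; rewrite <- !expl_shift; ring.
      * unfold laplace_value.
        replace (Csub (Csub (Cmul v c) (RtoC 0)) b) with qm by (unfold qm; ring).
        replace (Cadd (Cadd (Cmul v c) (RtoC 0)) b) with qp by (unfold qp; ring).
        replace (Cadd (Csub (Cmul v c) (RtoC 0)) b) with qp by (unfold qp; ring).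
        replace (Csub (Cadd (Cmul v c) (RtoC 0)) b) with qm by (unfold qm; ring).
        unfold qm, qp, shift in *; set (m := Cmul (RtoC (2 * INR n)) c) in *.
        (* The identity depends on 2 = 1 + 1, which [field] cannot see while [RtoC 2] is an atom. *)
        replace (RtoC 2) with (Cadd (RtoC 1) (RtoC 1)) in * by (cx; ring).
        field; repeat split; assumption.
      * apply improper_scale, improper_add; apply improper_xexp, Re_shift_pos; assumption.
  - assert (Ha : a <> RtoC 0) by (intro E; apply Ea; rewrite E, Cabs_RtoC; apply Rabs_R0).
    assert (H40 : RtoC 4 <> RtoC 0) by (apply RtoC_neq0; lra).
    assert (H4a : Cmul (RtoC 4) a <> RtoC 0) by (apply Cmul_neq0; assumption).
    set (q1 := Csub (Csub (Cmul v c) a) b) in *; set (q2 := Cadd (Cadd (Cmul v c) a) b) in *.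
    set (q3 := Cadd (Csub (Cmul v c) a) b) in *; set (q4 := Csub (Cadd (Cmul v c) a) b) in *.
    (* The 4 collects the halves in sinh and cosh; the factor a is the division that defines the
       kernel. *)
    set (k := Cinv (Cmul (RtoC 4) a)).
    set (g := fun x => Cmul k (Cadd (Cadd (expl q1 x) (expl q3 x)) (Cmul (RtoC (-1)) (Cadd (expl q4 x) (expl q2 x))))).
    exists g, (2 * (Cabs k * (Cabs q1 + Cabs q2 + Cabs q3 + Cabs q4))).
    split; [|split; [|split]].
    + pose proof (Cabs_ge0 q1); pose proof (Cabs_ge0 q2); pose proof (Cabs_ge0 q3); pose proof (Cabs_ge0 q4).
      pose proof (Cabs_ge0 k); assert (0 <= Cabs k * (Cabs q1 + Cabs q2 + Cabs q3 + Cabs q4)) by (apply Rmult_le_pos; lra); lra.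
    + intros x Hx.
      (* The bound K x is a Lipschitz estimate from 0: each exponential has modulus at most 1, and
         the factor 2 in K is that of [Cderiv_dominated]. *)
      assert (E0 : g 0 = RtoC 0).
      { unfold g, expl; replace (RtoC (-1)) with (Copp (RtoC 1)) by (cx; ring).
        replace (Cmul (Copp q1) (RtoC 0)) with (RtoC 0) by ring; replace (Cmul (Copp q2) (RtoC 0)) with (RtoC 0) by ring.
        replace (Cmul (Copp q3) (RtoC 0)) with (RtoC 0) by ring; replace (Cmul (Copp q4) (RtoC 0)) with (RtoC 0) by ring.
        rewrite Cexp_0; ring. }
      replace (g x) with (Csub (g x) (g 0)) by (rewrite E0; ring).
      rewrite Rmult_assoc.
      eapply Rle_trans.
      * apply (Cderiv_dominated g
          (fun t => Cmul k (Cadd (Cadd (Cmul (Copp q1) (expl q1 t)) (Cmul (Copp q3) (expl q3 t)))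
             (Cmul (RtoC (-1)) (Cadd (Cmul (Copp q4) (expl q4 t)) (Cmul (Copp q2) (expl q2 t))))))
          (fun t => Cabs k * (Cabs q1 + Cabs q2 + Cabs q3 + Cabs q4) * t)
          (fun t => Cabs k * (Cabs q1 + Cabs q2 + Cabs q3 + Cabs q4)) 0 x Hx).
        -- intros t _; apply Cderiv_scale, Cderiv_add; [|apply Cderiv_scale]; apply Cderiv_add; apply Cderiv_expl.
        -- intros t _; auto_derive; [exact I | ring].
        -- intros t [Ht _]; rewrite Cabs_mul; apply Rmult_le_compat_l; [apply Cabs_ge0|].
           assert (B : forall q, 0 < Re q -> Cabs (Cmul (Copp q) (expl q t)) <= Cabs q).
           { intros q Hq; rewrite Cabs_mul, Cabs_opp; rewrite <- (Rmult_1_r (Cabs q)) at 2.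
             apply Rmult_le_compat_l; [apply Cabs_ge0 | apply Cabs_expl_le1; assumption]. }
           assert (B1 := B q1 H1); assert (B2 := B q2 H2); assert (B3 := B q3 H3); assert (B4 := B q4 H4).
           eapply Rle_trans; [apply Cabs_add|]; rewrite Cabs_mul, Cabs_RtoC.
           replace (Rabs (-1)) with 1 by (rewrite Rabs_left; lra); rewrite Rmult_1_l.
           eapply Rle_trans; [apply Rplus_le_compat; apply Cabs_add | lra].
      * right; ring.
    + intro x; unfold g.
      set (V := expl (Cmul v c) x).
      set (A := Cexp (Cmul a (RtoC x))); set (A' := Cexp (Copp (Cmul a (RtoC x)))).
      set (B := Cexp (Cmul b (RtoC x))); set (B' := Cexp (Copp (Cmul b (RtoC x)))).
      assert (E1 : expl q1 x = Cmul V (Cmul A B)) by (unfold q1, V, A, B, expl; rewrite <- !Cexp_add; f_equal; ring).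
      assert (E2 : expl q2 x = Cmul V (Cmul A' B')) by (unfold q2, V, A', B', expl; rewrite <- !Cexp_add; f_equal; ring).
      assert (E3 : expl q3 x = Cmul V (Cmul A B')) by (unfold q3, V, A, B', expl; rewrite <- !Cexp_add; f_equal; ring).
      assert (E4 : expl q4 x = Cmul V (Cmul A' B)) by (unfold q4, V, A', B, expl; rewrite <- !Cexp_add; f_equal; ring).
      rewrite E1, E2, E3, E4; unfold Csinh, Ccosh, k; fold A A' B B'; rewrite RtoC_half.
      replace (RtoC (-1)) with (Copp (RtoC 1)) by (cx; ring).
      replace (RtoC 4) with (Cmul (RtoC 2) (RtoC 2)) by (cx; ring).
      field; split; assumption.
    + intro n.
      assert (N1 := Re_pos_neq0 _ (Re_shift_pos c n q1 Hc H1)).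
      assert (N2 := Re_pos_neq0 _ (Re_shift_pos c n q2 Hc H2)).
      assert (N3 := Re_pos_neq0 _ (Re_shift_pos c n q3 Hc H3)).
      assert (N4 := Re_pos_neq0 _ (Re_shift_pos c n q4 Hc H4)).
      apply (improper_ext (fun x => Cmul k (Cadd (Cadd (expl (shift c n q1) x) (expl (shift c n q3) x))
               (Cmul (RtoC (-1)) (Cadd (expl (shift c n q4) x) (expl (shift c n q2) x)))))
        _ (Cmul k (Cadd (Cadd (Cinv (shift c n q1)) (Cinv (shift c n q3)))
             (Cmul (RtoC (-1)) (Cadd (Cinv (shift c n q4)) (Cinv (shift c n q2))))))).
      * intro x; unfold g; rewrite <- !expl_shift; ring.
      * unfold laplace_value; fold q1 q2 q3 q4; unfold k.
        replace (RtoC (-1)) with (Copp (RtoC 1)) by (cx; ring).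
        replace (RtoC 4) with (Cmul (Cadd (RtoC 1) (RtoC 1)) (Cadd (RtoC 1) (RtoC 1))) in * by (cx; ring).
        unfold q1, q2, q3, q4, shift in *; set (m := Cmul (RtoC (2 * INR n)) c) in *.
        field; repeat split; assumption.
      * apply improper_scale, improper_add; [|apply improper_scale]; apply improper_add; apply improper_exp, Re_shift_pos; assumption.
Qed.

(** Both sides are (z)_(n+1), with the first or the last factor split off. *)
Lemma poch_shift z n : Cmul z (poch (Cadd (RtoC 1) z) n) = Cmul (poch z n) (Cadd z (RtoC (INR n))).
Proof.
  induction n as [|n IH]; cbn [poch]; [simpl INR; ring|].
  transitivity (Cmul (Cmul z (poch (Cadd (RtoC 1) z) n)) (Cadd (Cadd (RtoC 1) z) (RtoC (INR n)))); [ring|].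
  rewrite IH, S_INR, RtoC_add; ring.
Qed.

Lemma not_nonpos_int_neq z n : not_nonpos_int z -> Cadd z (RtoC (INR n)) <> RtoC 0.
Proof.
  intros Hz E; apply (Hz n); rewrite RtoC_opp.
  replace z with (Csub (Cadd z (RtoC (INR n))) (RtoC (INR n))) by ring; rewrite E; ring.
Qed.

Lemma poch_neq0 z n : not_nonpos_int z -> poch z n <> RtoC 0.
Proof.
  intro Hz; induction n as [|n IH]; cbn [poch]; [apply RtoC_neq0; lra|].
  apply Cmul_neq0; [exact IH | apply not_nonpos_int_neq, Hz].
Qed.

Lemma hyp_term_ratio (v s1 s2 s3 s4 s5 s6 : Cx) (n : nat) :
  not_nonpos_int s1 -> not_nonpos_int s2 ->
  not_nonpos_int (Cadd (RtoC 1) s3) -> not_nonpos_int (Cadd (RtoC 1) s4) ->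
  not_nonpos_int (Cadd (RtoC 1) s5) -> not_nonpos_int (Cadd (RtoC 1) s6) ->
  let N := RtoC (INR n) in
  Cadd s3 N <> RtoC 0 -> Cadd s4 N <> RtoC 0 -> Cadd s5 N <> RtoC 0 -> Cadd s6 N <> RtoC 0 ->
  hyp_term [v; Cadd (RtoC 1) s1; Cadd (RtoC 1) s2; s3; s4; s5; s6]
    [s1; s2; Cadd (RtoC 1) s3; Cadd (RtoC 1) s4; Cadd (RtoC 1) s5; Cadd (RtoC 1) s6] (RtoC (-1)) n =
  Cmul (bincoef v n)
    (Cmul (Cdiv (Cmul (Cadd s1 N) (Cadd s2 N)) (Cmul s1 s2))
      (Cdiv (Cmul (Cmul (Cmul s3 s4) s5) s6) (Cmul (Cmul (Cmul (Cadd s3 N) (Cadd s4 N)) (Cadd s5 N)) (Cadd s6 N)))).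
Proof.
  intros H1 H2 H3 H4 H5 H6 N N3 N4 N5 N6.
  assert (up : forall z, not_nonpos_int z -> poch (Cadd (RtoC 1) z) n = Cdiv (Cmul (poch z n) (Cadd z N)) z).
  { intros z Hz; assert (Hz0 := not_nonpos_int_neq z 0 Hz).
    assert (z <> RtoC 0) by (intro E; apply Hz0; rewrite E; cx; ring).
    unfold N; rewrite <- poch_shift; field; assumption. }
  (* Solved for (z)_n, so that for s3 to s6 the only divisors are z + N and the Pochhammer symbols
     of 1 + z, all known to be nonzero. *)
  assert (down : forall z, Cadd z N <> RtoC 0 -> poch z n = Cdiv (Cmul z (poch (Cadd (RtoC 1) z) n)) (Cadd z N)).
  { intros z Hz; rewrite poch_shift; fold N; field; assumption. }
  assert (nz : forall z, not_nonpos_int z -> z <> RtoC 0).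
  { intros z Hz E; apply (not_nonpos_int_neq z 0 Hz); rewrite E; cx; ring. }
  assert (F := INR_fact_Cx_neq0 n).
  assert (P1 := poch_neq0 _ n H1); assert (P2 := poch_neq0 _ n H2); assert (P3 := poch_neq0 _ n H3).
  assert (P4 := poch_neq0 _ n H4); assert (P5 := poch_neq0 _ n H5); assert (P6 := poch_neq0 _ n H6).
  assert (Z1 := nz _ H1); assert (Z2 := nz _ H2).
  unfold hyp_term, Cprod_list, bincoef; cbn [List.map List.fold_right].
  rewrite (up s1 H1), (up s2 H2), (down s3 N3), (down s4 N4), (down s5 N5), (down s6 N6).
  generalize dependent (poch (Cadd (RtoC 1) s3) n); generalize dependent (poch (Cadd (RtoC 1) s4) n).
  generalize dependent (poch (Cadd (RtoC 1) s5) n); generalize dependent (poch (Cadd (RtoC 1) s6) n).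
  generalize dependent (poch s1 n); generalize dependent (poch s2 n).
  intros; field; repeat split; assumption.
Qed.

(** * Passage to the series and the integral of the statement *)

Lemma series_converges_scale z f J : series_converges_to f J ->
  series_converges_to (fun n => Cmul z (f n)) (Cmul z J).
Proof.
  intros H eps Heps.
  assert (Hz := Cabs_ge0 z).
  destruct (H (eps / (Cabs z + 1))) as [N HN]; [apply Rdiv_lt_0_compat; lra|].
  exists N; intros n Hn; specialize (HN n Hn).
  replace (Csub (Csum (fun n => Cmul z (f n)) n) (Cmul z J)) with (Cmul z (Csub (Csum f n) J)).
  - rewrite Cabs_mul; apply (Rmult_lt_compat_r (Cabs z + 1)) in HN; [|lra].
    replace (eps / (Cabs z + 1) * (Cabs z + 1)) with eps in HN by (field; lra).
    assert (H0 := Cabs_ge0 (Csub (Csum f n) J)); nra.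
  - assert (E : Csum (fun n => Cmul z (f n)) n = Cmul z (Csum f n)).
    { clear; induction n as [|n IH]; cbn [Csum]; [ring | rewrite IH; ring]. }
    rewrite E; ring.
Qed.

Lemma series_converges_ext f g J : (forall n, f n = g n) -> series_converges_to f J -> series_converges_to g J.
Proof.
  intros E H eps Heps; destruct (H eps Heps) as [N HN]; exists N; intros n Hn.
  replace (Csum g n) with (Csum f n); [apply HN, Hn|].
  clear Hn; induction n as [|n IH]; cbn [Csum]; [reflexivity | rewrite IH, E; reflexivity].
Qed.

Lemma CInt_unique f u v L M : CInt f u v L -> CInt f u v M -> L = M.
Proof.
  intros [H1 H2] [H3 H4]; apply Cx_eq.
  - rewrite <- (is_RInt_unique _ _ _ _ H1); apply is_RInt_unique, H3.
  - rewrite <- (is_RInt_unique _ _ _ _ H2); apply is_RInt_unique, H4.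
Qed.

Lemma improper_integral_of_CInt f L :
  (forall T, exists I, CInt f 0 T I) ->
  (forall eps, 0 < eps -> exists M, forall T I, M <= T -> CInt f 0 T I -> Cabs (Csub I L) < eps) ->
  improper_integral_0_inf f L.
Proof.
  intros Hex Hlim.
  assert (pre : forall T, Riemann_integrable (fun x => Re (f x)) 0 T).
  { intro T; apply ex_RInt_Reals_0; destruct (Hex T) as [I [H1 H2]]; eexists; exact H1. }
  assert (pim : forall T, Riemann_integrable (fun x => Im (f x)) 0 T).
  { intro T; apply ex_RInt_Reals_0; destruct (Hex T) as [I [H1 H2]]; eexists; exact H2. }
  exists pre, pim; intros eps Heps; destruct (Hlim eps Heps) as [M HM]; exists M; intros T HT.
  destruct (Hex T) as [I HI]; specialize (HM T I (Rge_le _ _ HT) HI); destruct HI as [H1 H2].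
  rewrite <- !RInt_Reals, (is_RInt_unique _ _ _ _ H1), (is_RInt_unique _ _ _ _ H2).
  split; (eapply Rle_lt_trans; [|exact HM]); [apply (Rabs_Re_le (Csub I L)) | apply (Rabs_Im_le (Csub I L))].
Qed.

(** All factors of [cosh_pow] are exponentials, hence invertible for every real x, so the identity
    also holds where 1 + w lies on the cut. *)
Lemma cosh_pow_inv v c x N :
  Cdiv N (cosh_pow v c x) =
  Cmul (Cmul (Cexp (Cmul v (RtoC (ln 2)))) (Cmul N (expl (Cmul v c) x)))
    (Cexp (Cmul (Copp v) (Clog (one_plus_decay c x)))).
Proof.
  unfold cosh_pow, Cpow, expl.
  change (Cadd (RtoC 1) (Cexp (Cmul (RtoC (-2)) (Cmul c (RtoC x))))) with (one_plus_decay c x).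
  replace (Cmul (Copp v) (Clog (one_plus_decay c x))) with (Copp (Cmul v (Clog (one_plus_decay c x)))) by ring.
  replace (Cmul (Copp (Cmul v c)) (RtoC x)) with (Copp (Cmul v (Cmul c (RtoC x)))) by ring.
  rewrite !Cexp_opp; field; repeat split; apply Cexp_neq0.
Qed.

Theorem mainTheorem15 (v a b c s : Cx) :
  Re v < 3 ->
  Re c > 0 ->
  Re (Cadd (Cadd (Cmul v c) a) b) > 0 ->
  Re (Csub (Cadd (Cmul v c) a) b) > 0 ->
  Re (Cadd (Csub (Cmul v c) a) b) > 0 ->
  Re (Csub (Csub (Cmul v c) a) b) > 0 ->
  (* s is a fixed square root of a^2 - b^2 *)
  Cmul s s = Csub (Cmul a a) (Cmul b b) ->
  let v2 := Cdiv v (RtoC 2) in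
  let c2 := Cmul (RtoC 2) c in
  let sigma1 := Csub v2 (Cdiv s c2) in
  let sigma2 := Cadd v2 (Cdiv s c2) in
  let sigma3 := Csub (Csub v2 (Cdiv a c2)) (Cdiv b c2) in
  let sigma4 := Cadd (Csub v2 (Cdiv a c2)) (Cdiv b c2) in
  let sigma5 := Cadd (Cadd v2 (Cdiv a c2)) (Cdiv b c2) in
  let sigma6 := Csub (Cadd v2 (Cdiv a c2)) (Cdiv b c2) in
  let vc := Cmul v c in
  let P := Cmul (Cmul (Cmul (Csub (Csub vc a) b) (Cadd (Cadd vc a) b))
                      (Cadd (Csub vc a) b)) (Csub (Cadd vc a) b) in
  let one := RtoC 1 in
  not_nonpos_int sigma1 ->
  not_nonpos_int sigma2 ->
  not_nonpos_int (Cadd one sigma3) ->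
  not_nonpos_int (Cadd one sigma4) ->
  not_nonpos_int (Cadd one sigma5) ->
  not_nonpos_int (Cadd one sigma6) ->
  exists S : Cx,
    hypergeom_sum
      [v; Cadd one sigma1; Cadd one sigma2; sigma3; sigma4; sigma5; sigma6]
      [sigma1; sigma2; Cadd one sigma3; Cadd one sigma4; Cadd one sigma5; Cadd one sigma6]
      (RtoC (-1)) S /\
    improper_integral_0_inf
      (fun x : R =>
         Cdiv (Cmul (Csinh (Cmul a (RtoC x))) (Ccosh (Cmul b (RtoC x))))
              (cosh_pow v c x))
      (Cmul (Cdiv (Cmul (Cexp (Cmul v (RtoC (ln 2))))
                        (Cadd (Csub (Cmul (Cmul (Cmul v v) a) (Cmul c c))
                                    (Cmul (Cmul a a) a))
                              (Cmul a (Cmul b b))))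
                  P)
            S).
Proof.
  intros Hv Hc H2 H4 H3 H1 Hs v2 c2 sigma1 sigma2 sigma3 sigma4 sigma5 sigma6 vc P one S1 S2 S3 S4 S5 S6.
  destruct (kernel_exists v a b c Hc H2 H4 H3 H1) as (g & K & HK & Hg & Hga & Hgt).
  destruct (termwise_integration v c g (laplace_value v a b c) K Hv Hc HK Hg Hgt) as (J & HJ & HI).
  set (t := laplace_value v a b c) in *.
  assert (Hc0 := Re_pos_neq0 c Hc); assert (H20 := RtoC2_neq0).
  assert (Q1 := Re_pos_neq0 _ H1); assert (Q2 := Re_pos_neq0 _ H2).
  assert (Q3 := Re_pos_neq0 _ H3); assert (Q4 := Re_pos_neq0 _ H4).
  assert (HP : P <> RtoC 0) by (unfold P, vc; repeat apply Cmul_neq0; assumption).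
  assert (Ea : forall n z, Cadd (Cdiv z c2) (RtoC (INR n)) = Cdiv (shift c n z) c2).
  { intros n z; unfold shift, c2; rewrite RtoC_mul; field; split; assumption. }
  assert (E1 : sigma1 = Cdiv (Csub vc s) c2) by (unfold sigma1, v2, vc, c2; field; split; assumption).
  assert (E2 : sigma2 = Cdiv (Cadd vc s) c2) by (unfold sigma2, v2, vc, c2; field; split; assumption).
  assert (E3 : sigma3 = Cdiv (Csub (Csub vc a) b) c2) by (unfold sigma3, v2, vc, c2; field; split; assumption).
  assert (E4 : sigma4 = Cdiv (Cadd (Csub vc a) b) c2) by (unfold sigma4, v2, vc, c2; field; split; assumption).
  assert (E5 : sigma5 = Cdiv (Cadd (Cadd vc a) b) c2) by (unfold sigma5, v2, vc, c2; field; split; assumption).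
  assert (E6 : sigma6 = Cdiv (Csub (Cadd vc a) b) c2) by (unfold sigma6, v2, vc, c2; field; split; assumption).
  clearbody sigma1 sigma2 sigma3 sigma4 sigma5 sigma6.
  assert (Hc2 : c2 <> RtoC 0) by (unfold c2; apply Cmul_neq0; assumption).
  (* The case n = 0 of the assumptions on sigma1 and sigma2 makes the numerator of t 0 nonzero, so
     the series may be normalised by t 0. *)
  assert (Hm : Csub vc s <> RtoC 0).
  { intro E; apply (S1 0%nat); rewrite E1, E; cx; field; apply Cnorm2_neq0, Hc2. }
  assert (Hp : Cadd vc s <> RtoC 0).
  { intro E; apply (S2 0%nat); rewrite E2, E; cx; field; apply Cnorm2_neq0, Hc2. }
  assert (Et0 : t 0%nat = Cdiv (Cmul (Csub vc s) (Cadd vc s)) P).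
  { unfold t, laplace_value, P; rewrite !shift_0, <- Hs; fold vc; field; repeat split; assumption. }
  assert (Ht0 : t 0%nat <> RtoC 0).
  { intro E; apply (Cmul_neq0 _ _ Hm Hp); rewrite Et0 in E.
    replace (Cmul (Csub vc s) (Cadd vc s)) with (Cmul (Cdiv (Cmul (Csub vc s) (Cadd vc s)) P) P) by (field; exact HP).
    rewrite E; ring. }
  (* A hypergeometric series starts with 1, whereas the integrated binomial series starts with t
     0. *)
  exists (Cmul (Cinv (t 0%nat)) J); split.
  - unfold hypergeom_sum.
    apply (series_converges_ext (fun n => Cmul (Cinv (t 0%nat)) (Cmul (bincoef v n) (t n))));
      [|apply series_converges_scale, HJ].
    intro n.
    assert (R1 := Re_pos_neq0 _ (Re_shift_pos c n _ Hc H1)); assert (R2 := Re_pos_neq0 _ (Re_shift_pos c n _ Hc H2)).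
    assert (R3 := Re_pos_neq0 _ (Re_shift_pos c n _ Hc H3)); assert (R4 := Re_pos_neq0 _ (Re_shift_pos c n _ Hc H4)).
    fold vc in R1, R2, R3, R4.
    assert (Hdiv : forall z, z <> RtoC 0 -> Cdiv z c2 <> RtoC 0).
    { intros z Hz E; apply Hz; replace z with (Cmul (Cdiv z c2) c2) by (field; exact Hc2); rewrite E; ring. }
    symmetry; unfold one in *; rewrite hyp_term_ratio;
      try assumption; rewrite ?E3, ?E4, ?E5, ?E6, ?Ea; try (apply Hdiv; assumption).
    (* Each sigma and each sigma + n is a linear factor over 2c; the powers of 2c cancel and leave t
       n / t 0. *)
    rewrite E1, E2, !Ea, Et0; unfold t, laplace_value; rewrite <- Hs; fold vc; unfold P.
    unfold shift in *; set (m := Cmul (RtoC (2 * INR n)) c) in *.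
    field; repeat split; assumption.
  (* The prefactor of the statement is 2^v a times t 0, so against J / t 0 only k J with k = 2^v a
     remains; for a = 0 it vanishes, as does the integrand. *)
  - set (k := Cmul (Cexp (Cmul v (RtoC (ln 2)))) a).
    replace (Cmul _ (Cmul (Cinv (t 0%nat)) J)) with (Cmul k J).
    2: { replace (Cadd (Csub (Cmul (Cmul (Cmul v v) a) (Cmul c c)) (Cmul (Cmul a a) a)) (Cmul a (Cmul b b)))
           with (Cmul a (Cmul (Csub vc s) (Cadd vc s))).
         - rewrite Et0; unfold k; field; repeat split; assumption.
         - transitivity (Cmul a (Csub (Cmul vc vc) (Cmul s s))); [ring|]; rewrite Hs; unfold vc; ring. }
    set (f := fun x : R => Cdiv _ _).
    assert (Ef : forall x, f x = Cmul (Cmul k (g x)) (Cexp (Cmul (Copp v) (Clog (one_plus_decay c x))))).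
    { intro x; unfold f; rewrite cosh_pow_inv, Hga; unfold k; ring. }
    assert (Hgc : forall x, Ccontinuous g x).
    { intro x; destruct (Hgt 0%nat) as (_ & _ & Hcont & _); eapply Ccontinuous_ext; [|apply Hcont].
      intro; cbn [Cpow_nat]; ring. }
    assert (Hright : forall T, 0 <= T -> exists I,
      CInt (fun x => Cmul (g x) (power_decay (Copp v) c x)) 0 T I /\ CInt f 0 T (Cmul k I)).
    { intros T HT.
      destruct (CInt_continuous (fun x => Cmul (g x) (power_decay (Copp v) c x)) 0 T) as [I HInt].
      { intros x Hx; rewrite Rmin_left in Hx by assumption; apply Ccontinuous_mul; [apply Hgc|].
        eapply Cderiv_continuous, Cderiv_power_decay; [exact Hc | apply Hx]. }
      exists I; split; [exact HInt|].
      eapply CInt_ext; [|apply (CInt_scale k), HInt].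
      intros x Hx; rewrite Rmin_left in Hx by assumption.
      rewrite Ef, Clog_right by (apply one_plus_decay_pos; [exact Hc | lra]); unfold power_decay; ring. }
    apply improper_integral_of_CInt.
    + intro T; destruct (Rle_lt_dec 0 T) as [HT | HT].
      * destruct (Hright T HT) as (I & _ & HInt); eexists; exact HInt.
      (* For negative T the integral from T to 0 exists piecewise, and reversing the orientation
         changes its sign. *)
      * destruct (CInt_left (fun x => Cmul k (g x)) (Copp v) c T Hc) as [I HInt]; [|lra|].
        { intro x; apply Ccontinuous_mul; [apply Ccontinuous_const | apply Hgc]. }
        exists (Copp I); apply (CInt_ext _ f) in HInt; [|intros; rewrite Ef; reflexivity].
        destruct HInt as [I1 I2]; split; simpl; apply (@is_RInt_swap R_NormedModule); assumption.
    + intros eps Heps; assert (Hk := Cabs_ge0 k).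
      destruct (HI (eps / (Cabs k + 1))) as (M & HM & HIM); [apply Rdiv_lt_0_compat; lra|].
      exists M; intros T I HT HInt.
      destruct (Hright T) as (I' & H5 & H6); [lra|].
      rewrite (CInt_unique _ _ _ _ _ HInt H6); specialize (HIM T I' HT H5).
      replace (Csub (Cmul k I') (Cmul k J)) with (Cmul k (Csub I' J)) by ring.
      rewrite Cabs_mul; apply (Rmult_lt_compat_r (Cabs k + 1)) in HIM; [|lra].
      replace (eps / (Cabs k + 1) * (Cabs k + 1)) with eps in HIM by (field; lra).
      assert (H0 := Cabs_ge0 (Csub I' J)); nra.
Qed.
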